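(* Let $k$ be a field of characteristic $p>0$, let $1\le m\le n$, let $R=k[x_{11},\dots,x_{mn}]$, let $X=[x_{ij}]$ be the $m\times n$ matrix of indeterminates, and let $I=I_m(X)$ be the ideal of $R$ generated by the maximal ($m\times m$) minors of $X$. Then $\operatorname{fpt}(I)=n-m+1$, the set of $F$-jumping numbers ($F$-thresholds) of $I$ is $\{N\in\mathbb{Z}\mid N\ge \operatorname{fpt}(I)\}$, and for every real $\lambda\ge \operatorname{fpt}(I)-1$, $$\tau(\lambda\bullet I)=I^{\lfloor\lambda\rfloor-\operatorname{fpt}(I)+1}=I^{\lfloor\lambda\rfloor-n+m}.$$ (In particular $\tau(\lambda\bullet I)=R$ for $0\le\lambda<n-m+1$.)
   Context: For an ideal $\mathfrak a$ of $R$ and $q=p^e$, the $e$-th root ideal $\mathfrak a^{[1/q]}$ is the unique smallest ideal $\mathfrak b$ of $R$ with $\mathfrak a\subseteq \mathfrak b^{[q]}$, where $\mathfrak b^{[q]}$ is the ideal generated by $q$-th powers of elements of $\mathfrak b$. Concretely, if $\mathcal B_e$ is a basis of $R$ as a module over $R^{q}=\{r^q: r\in R\}$ (for $k$ $F$-finite one may take $\alpha x^{u}$ with $\alpha$ in a $k^{q}$-basis of $k$ and monomials $x^u$ with all exponents $\le q-1$) and $\mathfrak a=(a_1,\dots,a_s)$ with $a_i=\sum_{\mu\in\mathcal B_e} g_{i\mu}^q\mu$, then $\mathfrak a^{[1/q]}=(g_{i\mu})$. For real $\lambda>0$, the generalized test ideal is $\tau(\lambda\bullet\mathfrak a)=\bigcup_{e\ge0}(\mathfrak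 a^{\lceil\lambda p^e\rceil})^{[1/p^e]}$, which equals $(\mathfrak a^{\lceil\lambda p^e\rceil})^{[1/p^e]}$ for $e\gg0$; and $\tau(0\bullet\mathfrak a)=R$. An $F$-jumping number of $\mathfrak a$ is a $\lambda>0$ with $\tau(\lambda\bullet\mathfrak a)\ne\tau((\lambda-\delta)\bullet\mathfrak a)$ for all $\delta>0$; the $F$-pure threshold is $\operatorname{fpt}(\mathfrak a)=\min\{\lambda>0:\tau(\lambda\bullet\mathfrak a)\ne R\}$. *)

(* Defs.v *)
From HB Require Import structures.
From mathcomp Require Import all_boot all_order all_algebra.
From mathcomp Require Import mpoly.
From mathcomp Require Import reals.
Set Implicit Arguments. Unset Strict Implicit. Unset Printing Implicit Defensive.
Import Order.TTheory GRing.Theory Num.Theory.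
Local Open Scope ring_scope.

Section Ideals.
Variable R : comNzRingType.

Definition is_ideal (J : R -> Prop) : Prop :=
  J 0 /\ (forall x y, J x -> J y -> J (x + y)) /\ (forall r x, J x -> J (r * x)).

Definition set_eq (A B : R -> Prop) : Prop := forall x, A x <-> B x.

Definition subset (A B : R -> Prop) : Prop := forall x, A x -> B x.

Definition gen_ideal (S : R -> Prop) : R -> Prop :=
  fun x => forall J, is_ideal J -> subset S J -> J x.

Definition unit_ideal : R -> Prop := fun _ => True.

Definition ideal_pow (a : R -> Prop) (N : nat) : R -> Prop :=
  gen_ideal (fun x => exists s : seq R,
                 size s = N /\ (forall y, y \in s -> a y) /\ x = \prod_(y <- s) y).

Definition frob_pow (b : R -> Prop) (q : nat) : R -> Prop :=
  gen_ideal (fun x => exists y, b y /\ x = y ^+ q).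

(* The root ideal a^[1/q]: the smallest ideal b with a ⊆ b^[q]
   (realized as the intersection of all such ideals). *)
Definition root_ideal (a : R -> Prop) (q : nat) : R -> Prop :=
  fun x => forall b, is_ideal b -> subset a (frob_pow b q) -> b x.

Definition test_ideal (Rl : realType) (p : nat) (lambda : Rl) (a : R -> Prop)
  : R -> Prop :=
  if lambda <= 0 then unit_ideal
  else fun x => exists e : nat,
      root_ideal (ideal_pow a `|Num.ceil (lambda * (p ^ e)%:R)|%N) (p ^ e) x.

Definition F_jumping (Rl : realType) (p : nat) (a : R -> Prop) (lambda : Rl)
  : Prop :=
  0 < lambda /\
  forall delta : Rl, 0 < delta ->
    ~ set_eq (test_ideal p lambda a) (test_ideal p (lambda - delta) a).

Definition is_fpt (Rl : realType) (p : nat) (a : R -> Prop) (c : Rl) : Prop :=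
  0 < c /\ ~ set_eq (test_ideal p c a) unit_ideal /\
  forall lambda : Rl, 0 < lambda ->
    ~ set_eq (test_ideal p lambda a) unit_ideal -> c <= lambda.

End Ideals.

Definition generic_matrix (k : fieldType) (m n : nat) : 'M[{mpoly k[m * n]}]_(m, n) :=
  \matrix_(i < m, j < n) 'X_(mxvec_index i j).

Definition maximal_minors_ideal (k : fieldType) (m n : nat) : {mpoly k[m * n]} -> Prop :=
  gen_ideal (fun x => exists f : 'I_m -> 'I_n,
     (forall i j : 'I_m, (i < j)%N -> (f i < f j)%N) /\
     x = \det (\matrix_(i < m, j < m) generic_matrix k m n i (f j))).
Arguments generic_matrix : clear implicits.
Arguments maximal_minors_ideal : clear implicits.
Arguments unit_ideal {R}.

(* Main.v *)
Require Import Defs.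
From HB Require Import structures.
From mathcomp Require Import all_boot all_order all_algebra all_fingroup.
From mathcomp Require Import mpoly.
From mathcomp Require Import reals.
From mathcomp Require Import zify ring lra.
Set Implicit Arguments. Unset Strict Implicit. Unset Printing Implicit Defensive.
Import Order.TTheory GRing.Theory Num.Theory.
Local Open Scope ring_scope.

(** Write [q = p ^ e], [h = n - m + 1] and [I^[q]] for the Frobenius power.

    Lower bound.  Let [D_1, ..., D_h] be the minors on consecutive columns.  Their
    diagonals are disjoint, so [f = (D_1 ... D_h)^(q-1)] has leading monomial
    [x^u] with all exponents [< q] and the [R^q]-coordinate of [f] at [x^u] is [1].
    Hence, if [g] is a product of [r] minors and [g^q f] lies in [b^[q]], then [g]
    lies in [b].

    Upper bound.  We need [I^((r+h-1)q) <= (I^r)^[q]].  Let [c] be the [(m-1)]-minor of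
    the first columns omitting the last row.  Then [c I] is contained in the ideal of
    the [h] minors on the columns [1, ..., m-1, j], so the pigeonhole principle gives
    [c^N I^((r+h-1)q) <= (I^r)^[q]], and it remains to see that [c] is a non-zero-divisor
    modulo [I^r] (Frobenius being flat).

    To this end map [x_ij] to the entries of [adj(Y) X], where [Z = [X | Y]] is a generic
    [m x (n+m)] matrix; these, the minors of [X] and [c] become products of maximal minors
    of [Z].  By straightening, the products of maximal minors of [Z] with at least [r]
    factors in the columns of [X] are spanned by the standard ones with this
    property.  Standard products have distinct leading monomials, and multiplication by a
    minor whose last column belongs to [Y] does not change the number of factors in the
    columns of [X] that one reads off from the leading monomial. *)

(** * Minors and column exchange *)
Section Minors.
Variable R : comNzRingType.

(** Multilinearity in the columns: each factor of a Leibniz product is a sum of two entries, and [t]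
    records the choice made in each column. *)
Lemma det_add_cols n (U V : 'M[R]_n) :
  \det (U + V) = \sum_(t : {ffun 'I_n -> bool})
                   \det (\matrix_(i, j) (if t j then U i j else V i j)).
Proof.
rewrite -det_tr /determinant.
transitivity (\sum_(s : 'S_n) \sum_(t : {ffun 'I_n -> bool})
   (-1) ^+ s * \prod_i (if t i then U (s i) i else V (s i) i)).
  apply: eq_bigr => s _.
  rewrite -big_distrr /= -(bigA_distr_bigA (fun i b => if b then U (s i) i else V (s i) i)).
  congr (_ * _); apply: eq_bigr => i _.
  by rewrite !mxE big_bool.
rewrite exchange_big; apply: eq_bigr => t _.
rewrite -[RHS]det_tr /determinant; apply: eq_bigr => s _.
by congr (_ * _); apply: eq_bigr => i _; rewrite !mxE.
Qed.

(** If some permutation lists [m] columns satisfying [t] and then [m] others, it makes the matrix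
    block diagonal. If there is none, every Leibniz term contains a zero entry. *)
Lemma det_split_cols m (M : 'M[R]_(m + m)) (t : pred 'I_(m + m)) :
  (forall i j, t j -> M (rshift m i) j = 0) ->
  (forall i j, ~~ t j -> M (lshift m i) j = 0) ->
  \det M = 0 \/ exists s : 'S_(m + m), \det M = (-1) ^+ s *
    (\det (\matrix_(i, j) M (lshift m i) (s (lshift m j))) *
     \det (\matrix_(i, j) M (rshift m i) (s (rshift m j)))).
Proof.
move=> tdn tup.
case: (pickP (fun s : 'S_(m + m) =>
   [forall i, t (s (lshift m i)) && ~~ t (s (rshift m i))])) => [s /forallP hs|no].
  right; exists s.
  have -> : \det M = (-1) ^+ s * \det (col_perm s M).
    by rewrite col_permE det_mulmx det_perm odd_permV mulrCA -signr_addb addbb mulr1.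
  congr (_ * _); rewrite -(det_lblock _ 0); congr (\det _); apply/matrixP => i j.
  rewrite -[i]splitK -[j]splitK.
  case: (split i) => i'; case: (split j) => j' /=;
    rewrite ?block_mxEul ?block_mxEur ?block_mxEdl ?block_mxEdr !mxE //.
    by have /andP[_ /tup ->] := hs j'.
  by have /andP[/tdn -> _] := hs j'.
left; rewrite /determinant big1 // => s _.
have /forallPn[i] : ~~ [forall i, t (s (lshift m i)) && ~~ t (s (rshift m i))].
  by rewrite no.
rewrite negb_and negbK => /orP[] h.
  by rewrite (bigD1 (lshift m i)) //= tup // mul0r mulr0.
by rewrite (bigD1 (rshift m i)) //= tdn // mul0r mulr0.
Qed.

Variables (m N : nat) (X : 'M[R]_(m, N)).

Definition minor (a : 'I_m -> 'I_N) := \det (\matrix_(i < m, j < m) X i (a j)).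

Lemma eq_minor a b : a =1 b -> minor a = minor b.
Proof. by move=> e; congr (\det _); apply/matrixP => i j; rewrite !mxE e. Qed.

Lemma minor_perm a (s : 'S_m) : minor (a \o s) = (-1) ^+ s * minor a.
Proof.
rewrite /minor (_ : \matrix_(_, _) _ = col_perm s (\matrix_(i, j) X i (a j))).
  by rewrite col_permE det_mulmx det_perm odd_permV mulrC.
by apply/matrixP => i j; rewrite !mxE.
Qed.

Lemma minor_ninj a : ~ injective a -> minor a = 0.
Proof.
move=> /injectiveP/injectivePn[i [j ij aij]].
rewrite /minor -det_tr; apply: (determinant_alternate ij) => l.
by rewrite !mxE aij.
Qed.

(* [minor a * minor b] is the determinant of [[A, BQ], [-A, B - BQ]], where [BQ]
   keeps the columns of [B] selected by [Q]; splitting each column into its two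
   halves gives the Laplace expansion along the first [m] rows. *)
Lemma minor_exchange (S : R -> Prop) a b (Q : pred 'I_m) :
  S 0 -> (forall x y, S x -> S y -> S (x + y)) -> (forall x, S x -> S (- x)) ->
  (forall a' b', (forall j, Q j -> exists i, a' i = b j) ->
     (forall i, (exists j, a' i = a j) \/ (exists2 j, Q j & a' i = b j)) ->
     (forall i, (exists j, b' i = a j) \/ (exists j, b' i = b j)) ->
     S (minor a' * minor b')) ->
  S (minor a * minor b).
Proof.
move=> S0 SD SN H.
have Ssg (e : bool) x : S x -> S ((-1) ^+ e * x).
  by move=> Sx; case: e; rewrite ?expr0 ?expr1 ?mul1r // mulN1r; apply: SN.
pose A := \matrix_(i, j) X i (a j); pose B := \matrix_(i, j) X i (b j).
pose BQ := \matrix_(i, j) if Q j then X i (b j) else 0.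
pose M := block_mx A BQ (- A) (B - BQ).
have -> : minor a * minor b = \det M.
  have : \det (block_mx 1%:M 0 1%:M 1%:M *m M) = minor a * minor b.
    rewrite mulmx_block !mul1mx !mul0mx !addr0 subrr addrC subrK.
    by rewrite det_ublock.
  by rewrite det_mulmx det_lblock !det1 !mul1r => <-.
pose U : 'M[R]_(m + m) := block_mx A BQ 0 0.
pose V : 'M[R]_(m + m) := block_mx 0 0 (- A) (B - BQ).
have -> : M = U + V by rewrite add_block_mx !addr0 !add0r.
rewrite det_add_cols; apply: big_ind => // t _.
set Mt := \matrix_(_, _) _.
have lE i j : U (lshift m i) j = (row_mx A BQ) i j.
  by rewrite /U /block_mx col_mxEu.
have lE0 i j : U (rshift m i) j = 0.
  by rewrite /U /block_mx col_mxEd row_mx0 mxE.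
have rE i j : V (rshift m i) j = (row_mx (- A) (B - BQ)) i j.
  by rewrite /V /block_mx col_mxEd.
have rE0 i j : V (lshift m i) j = 0.
  by rewrite /V /block_mx col_mxEu row_mx0 mxE.
have [||->|[s ->]] := @det_split_cols _ Mt t; rewrite //.
- by move=> i j tj; rewrite mxE tj lE0.
- by move=> i j /negbTE tj; rewrite mxE tj rE0.
apply: (Ssg s).
set U' := \matrix_(_, _) _; set V' := \matrix_(_, _) _.
have det0 (W : 'M[R]_m) j : (forall i, W i j = 0) -> \det W = 0.
  by move=> W0; rewrite (expand_det_col _ j) big1 // => i _; rewrite W0 mul0r.
case: (boolP [exists j, ~~ t (s (lshift m j))]) => [/existsP[j tj]|].
  by rewrite (det0 U' j) ?mul0r // => i; rewrite 2!mxE (negbTE tj) rE0.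
rewrite negb_exists => /forallP tl.
case: (boolP [exists j, t (s (rshift m j))]) => [/existsP[j tj]|].
  by rewrite (det0 V' j) ?mulr0 // => i; rewrite 2!mxE tj lE0.
rewrite negb_exists => /forallP tr.
pose col (c : 'I_(m + m)) := match split c with inl j => a j | inr j => b j end.
pose a' j := col (s (lshift m j)); pose b' j := col (s (rshift m j)).
(* A column of [b] is zero in the upper half when outside [Q], and zero in the lower half when in
   [Q]. A nonzero term thus has exactly the [Q]-columns of [b] in its first factor. *)
case: (boolP [exists j, exists l, (s (lshift m j) == rshift m l) && ~~ Q l]).
  move=> /existsP[j /existsP[l /andP[/eqP jl Ql]]].
  rewrite (det0 U' j) ?mul0r // => i; rewrite 2!mxE (negPn (tl j)) lE jl.
  by rewrite row_mxEr mxE (negbTE Ql).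
rewrite negb_exists => /forallP hU.
case: (boolP [exists j, exists l, (s (rshift m j) == rshift m l) && Q l]).
  move=> /existsP[j /existsP[l /andP[/eqP jl Ql]]].
  rewrite (det0 V' j) ?mulr0 // => i; rewrite 2!mxE (negbTE (tr j)) rE jl.
  by rewrite row_mxEr !mxE Ql subrr.
rewrite negb_exists => /forallP hV.
have -> : \det U' = minor a'.
  congr (\det _); apply/matrixP => i j.
  rewrite [LHS]mxE [LHS]mxE [RHS]mxE (negPn (tl j)) lE /a' /col.
  rewrite -{1}[s (lshift m j)]splitK; case E : (split _) => [l|l] /=.
    by rewrite row_mxEl mxE.
  rewrite row_mxEr mxE; move: (hU j); rewrite negb_exists => /forallP/(_ l).
  have -> : s (lshift m j) = rshift m l by rewrite -[LHS]splitK E.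
  by rewrite eqxx negbK => ->.
(* Columns of [A] enter the lower half with sign [-1]. *)
pose sg (j : 'I_m) : R := match split (s (rshift m j)) with inl _ => -1 | inr _ => 1 end.
have -> : \det V' = minor b' * \prod_j sg j.
  rewrite /minor -[X in _ * X](_ : \det (diag_mx (\row_j sg j)) = _); last first.
    by rewrite det_diag; apply: eq_bigr => j _; rewrite mxE.
  rewrite -det_mulmx; congr (\det _); apply/matrixP => i j.
  rewrite mul_mx_diag [LHS]mxE [LHS]mxE [RHS]mxE [X in X * _]mxE [X in _ * X]mxE.
  rewrite (negbTE (tr j)) rE /b' /col /sg.
  rewrite -{1}[s (rshift m j)]splitK; case E : (split _) => [l|l] /=.
    by rewrite row_mxEl !mxE mulrN1.
  rewrite row_mxEr !mxE; move: (hV j); rewrite negb_exists => /forallP/(_ l).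
  have -> : s (rshift m j) = rshift m l by rewrite -[LHS]splitK E.
  by rewrite eqxx /= => /negbTE ->; rewrite subr0 mulr1.
have [e ->] : exists e : bool, \prod_j sg j = (-1) ^+ e.
  apply: (big_ind (fun x : R => exists e : bool, x = (-1) ^+ e)).
  - by exists false.
  - by move=> x y [e1 ->] [e2 ->]; exists (e1 (+) e2); rewrite signr_addb.
  - by move=> j _; rewrite /sg; case: split; [exists true|exists false].
rewrite mulrA [X in S X]mulrC; apply: Ssg; apply: H.
  move=> j Qj; have := permKV s (rshift m j).
  rewrite -[(s^-1)%g _]splitK; case: (split _) => i /= E.
    by exists i; rewrite /a' /col E (unsplitK (inr _ j)).
  move: (hV i); rewrite negb_exists => /forallP/(_ j).
  by rewrite E eqxx Qj.
  move=> i; rewrite /a' /col; case E : (split _) => [l|l]; first by left; exists l.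
  right; exists l => //; move: (hU i); rewrite negb_exists => /forallP/(_ l).
  by rewrite -[s _]splitK E /= eqxx negbK.
move=> i; rewrite /b' /col; case: (split _) => l; [left|right]; by exists l.
Qed.

End Minors.

(** * Column sets and their colexicographic rank *)

Section Columns.
Variables m N : nat.
Implicit Types a b : 'I_m -> 'I_N.

Definition increasing a := [forall i : 'I_m, forall j : 'I_m, (i < j) ==> (a i < a j)]%N.

Lemma increasingP a : reflect (forall i j : 'I_m, (i < j)%N -> (a i < a j)%N) (increasing a).
Proof.
apply: (iffP idP) => [/forallP h i j ij|h].
  by have /forallP/(_ j) := h i; rewrite ij.
by apply/forallP => i; apply/forallP => j; apply/implyP; apply: h.
Qed.

Lemma increasing_inj a : increasing a -> injective a.
Proof.
move=> /increasingP h i j e; apply/val_inj.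
by case: (ltngtP i j) => // /h; rewrite e ltnn.
Qed.

Lemma increasing_le a (i j : 'I_m) : increasing a -> (i <= j)%N -> (a i <= a j)%N.
Proof.
move=> /increasingP h; rewrite leq_eqVlt => /orP[/eqP/val_inj -> //|/h].
exact: ltnW.
Qed.

Lemma increasing_perm a : injective a -> exists s : 'S_m, increasing (a \o s).
Proof.
move=> inj_a; pose t := [tuple a i | i < m].
pose ts := [tuple of sort (fun x y : 'I_N => x <= y)%N t].
have /tuple_permP[s ts_s] : perm_eq ts t by rewrite perm_sort.
have tsE i : tnth ts i = a (s i).
  have -> : ts = [tuple tnth t (s i) | i < m] by exact/val_inj.
  by rewrite !tnth_mktuple.
exists s; apply/increasingP => i j ij /=.
rewrite ltn_neqAle; apply/andP; split.
  by apply/negP => /eqP/val_inj/inj_a/perm_inj e; rewrite e ltnn in ij.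
have srt : sorted (fun x y : 'I_N => x <= y)%N ts.
  by apply: sort_sorted => x y; apply: leq_total.
rewrite -!tsE !(tnth_nth (a i)).
apply: (sorted_leq_nth _ _ _ srt) => //.
- by move=> x y z; apply: leq_trans.
- by rewrite inE size_tuple.
- by rewrite inE size_tuple.
- exact: ltnW.
Qed.

(* The binary value of the set of columns, i.e. its rank in the colexicographic order. *)
Definition colex a := (\sum_i 2 ^ a i)%N.

Lemma colex_perm a (s : 'S_m) : colex (a \o s) = colex a.
Proof. by rewrite /colex [RHS](reindex_inj (@perm_inj _ s)). Qed.

Lemma sum_pow2_lt (v : nat) (A : {set 'I_N}) :
  (forall x, x \in A -> x < v)%N -> (\sum_(x in A) 2 ^ x < 2 ^ v)%N.
Proof.
move=> Av.
have sum_pow2 w : ((\sum_(0 <= x < w) 2 ^ x).+1 = 2 ^ w)%N.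
  elim: w => [|w IH]; first by rewrite big_nil.
  by rewrite big_nat_recr //= -addSn IH expnS mul2n addnn.
rewrite -sum_pow2 ltnS.
have -> : (\sum_(x in A) 2 ^ x = \sum_(y <- map val (enum A)) 2 ^ y)%N.
  by rewrite big_map -big_enum.
apply: leq_trans (_ : _ <= \sum_(y <- index_iota 0 v | y \in map val (enum A)) 2 ^ y)%N _.
  rewrite -[X in (_ <= X)%N]big_filter; apply: eq_leq; apply: perm_big.
  apply: uniq_perm.
  - by rewrite map_inj_uniq ?enum_uniq //; apply: val_inj.
  - by rewrite filter_uniq // iota_uniq.
  move=> y; rewrite mem_filter mem_index_iota /=.
  case: (boolP (y \in _)) => //= /mapP[x xA ->]; rewrite Av //.
  by rewrite mem_enum in xA.
by rewrite big_mkcond; apply: leq_sum => y _; case: ifP.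
Qed.

(** Compare the columns that are at least [a s]. Those of [a'] come from [a], since
    [b j <= b s < a s] for [j <= s]. As [a'] contains the [s + 1] columns [b j] below [a s], it has
    fewer than [m - s] such columns, so it loses one of [a]. The lost power of two exceeds the sum
    of all powers contributed below [a s]. *)
Lemma colex_exchange a b a' (s : 'I_m) :
  increasing a -> increasing b -> (b s < a s)%N -> injective a' ->
  (forall j : 'I_m, (j <= s)%N -> exists i, a' i = b j) ->
  (forall i, (exists j, a' i = a j) \/ (exists2 j : 'I_m, (j <= s)%N & a' i = b j)) ->
  (colex a' < colex a)%N.
Proof.
move=> ia ib bs inj' hb ha.
have imE c : injective c -> colex c = (\sum_(x in c @: [set: 'I_m]) 2 ^ x)%N.
  move=> ic; rewrite big_imset /=; last by move=> x y _ _; apply: ic.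
  by apply: eq_bigl => i; rewrite inE.
have cardE (c : 'I_m -> 'I_N) : injective c -> #|c @: [set: 'I_m]| = m.
  by move=> ic; rewrite card_imset // cardsT card_ord.
rewrite (imE _ inj') (imE _ (increasing_inj ia)).
move: (cardE _ inj').
set A' := a' @: _; set A := a @: _ => cA'.
pose hi := [set x : 'I_N | a s <= x]%N.
have bj (j : 'I_m) : (j <= s)%N -> (b j < a s)%N.
  by move=> js; apply: leq_ltn_trans bs; apply: increasing_le.
have subA : A' :&: hi \subset A :&: hi.
  apply/subsetP => x; rewrite !inE => /andP[/imsetP[i _ ->] h]; rewrite h andbT.
  case: (ha i) => [[j ->]|[j js e]]; first by apply: imset_f.
  by move: (bj _ js); rewrite -e ltnNge h.
have clo : (s < #|A' :\: hi|)%N.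
  pose B := b @: [set j : 'I_m | j <= s]%N.
  have <- : #|B| = s.+1.
    rewrite card_imset; last exact: increasing_inj.
    pose w (i : 'I_s.+1) : 'I_m := widen_ord (ltn_ord s) i.
    have -> : [set j : 'I_m | (j <= s)%N] = w @: [set: 'I_s.+1].
      apply/setP => j; rewrite inE; apply/idP/imsetP => [js|[i _ ->]].
        by exists (Ordinal (js : (j < s.+1)%N)) => //; apply: val_inj.
      by rewrite /= -ltnS.
    rewrite card_imset ?cardsT ?card_ord // => x y /(congr1 val) /= e.
    exact: val_inj.
  apply: subset_leq_card; apply/subsetP => x /imsetP[j]; rewrite inE => js ->.
  have [i e] := hb j js; rewrite !inE -ltnNge bj //= -e.
  exact: imset_f.
have cup : (m - s <= #|A :&: hi|)%N.
  have -> : (m - s)%N = #|a @: [set j : 'I_m | s <= j]%N|.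
    rewrite card_imset; last exact: increasing_inj.
    have hms : (s + (m - s) = m)%N by rewrite subnKC // ltnW.
    pose w (i : 'I_(m - s)) : 'I_m := cast_ord hms (rshift s i).
    have -> : [set j : 'I_m | (s <= j)%N] = w @: [set: 'I_(m - s)].
      apply/setP => j; rewrite inE; apply/idP/imsetP => [js|[i _ ->]].
        have js' : (j - s < m - s)%N by have := ltn_ord j; lia.
        by exists (Ordinal js') => //; apply: val_inj => /=; lia.
      by rewrite /= leq_addr.
    rewrite card_imset ?cardsT ?card_ord // => x y /(congr1 val) /= e.
    by apply: val_inj => /=; lia.
  apply: subset_leq_card; apply/subsetP => x /imsetP[j]; rewrite inE => js ->.
  rewrite inE; apply/andP; split; first exact: imset_f.
  by rewrite inE; apply: increasing_le.
have /properP[_ [y yA yA']] : A' :&: hi \proper A :&: hi.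
  rewrite properEcard subA /=; apply: leq_trans cup.
  move: (cardsID hi A') clo; rewrite cA'; move: (ltn_ord s).
  by move: (nat_of_ord s) #|A' :&: hi| #|A' :\: hi| => i x y; lia.
rewrite (big_setID hi) [X in (_ < X)%N](big_setID hi) /=.
apply: leq_trans (leq_addr _ _).
rewrite [X in (_ <= X)%N](bigD1 y) //= addnC -addSn; apply: leq_add.
  apply: leq_trans (_ : 2 ^ a s <= _)%N.
    by apply: sum_pow2_lt => x; rewrite !inE -ltnNge => /andP[].
  by rewrite leq_pexp2l //; move: yA; rewrite !inE => /andP[].
rewrite big_mkcond [X in (_ <= X)%N]big_mkcond; apply: leq_sum => x _.
case: ifP => // xA'; rewrite (subsetP subA) //=.
by case: eqP => // e; rewrite -e xA' in yA'.
Qed.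

End Columns.
(** * Straightening *)

Section Span.
Variables (K : comNzRingType) (V : lmodType K).

Inductive span (B : V -> Prop) : V -> Prop :=
| span0 : span B 0
| spanDZ c b x : B b -> span B x -> span B (c *: b + x).

Lemma spanD (B : V -> Prop) x y : span B x -> span B y -> span B (x + y).
Proof.
elim=> [|c b z Bb _ IH] Sy; first by rewrite add0r.
by rewrite -addrA; apply: spanDZ => //; apply: IH.
Qed.

Lemma spanZ (B : V -> Prop) c x : span B x -> span B (c *: x).
Proof.
elim=> [|d b z Bb _ IH]; first by rewrite scaler0; apply: span0.
by rewrite scalerDr scalerA; apply: spanDZ.
Qed.

Lemma spanN (B : V -> Prop) x : span B x -> span B (- x).
Proof. by rewrite -scaleN1r; apply: spanZ. Qed.

Lemma span_gen (B : V -> Prop) b : B b -> span B b.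
Proof.
move=> Bb; rewrite -[b]scale1r -[_ *: b]addr0; apply: spanDZ => //.
exact: span0.
Qed.

Lemma span_closed (B P : V -> Prop) :
  P 0 -> (forall x y, P x -> P y -> P (x + y)) -> (forall c x, P x -> P (c *: x)) ->
  (forall b, B b -> P b) -> forall x, span B x -> P x.
Proof. by move=> P0 PD PZ BP x; elim=> // c b y /BP Pb _ Py; apply/PD/Py/PZ. Qed.

Lemma span_span (B C : V -> Prop) :
  (forall b, B b -> span C b) -> forall x, span B x -> span C x.
Proof.
move=> h; apply: span_closed => //; [exact: span0|exact: spanD|exact: spanZ].
Qed.

Lemma sub_span (B C : V -> Prop) :
  (forall b, B b -> C b) -> forall x, span B x -> span C x.
Proof. by move=> h; apply: span_span => b /h; apply: span_gen. Qed.

End Span.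

Lemma span_mul (K : comNzRingType) (A : comAlgType K) (B C D : A -> Prop) :
  (forall b c, B b -> C c -> D (b * c)) ->
  forall x y, span B x -> span C y -> span D (x * y).
Proof.
move=> h x y Bx Cy; move: x Bx.
apply: span_closed => [|x z||b Bb].
- by rewrite mul0r; apply: span0.
- by rewrite mulrDl; apply: spanD.
- by move=> c x; rewrite -scalerAl; apply: spanZ.
move: y Cy; apply: span_closed => [|x z||c Cc].
- by rewrite mulr0; apply: span0.
- by rewrite mulrDr; apply: spanD.
- by move=> c x; rewrite -scalerAr; apply: spanZ.
by apply/span_gen/h.
Qed.

Section Straightening.
Variables (k : fieldType) (A : comAlgType k) (m N : nat) (X : 'M[A]_(m, N)).

Notation tableau := (seq {ffun 'I_m -> 'I_N}).
Implicit Types (T : tableau) (a b : {ffun 'I_m -> 'I_N}).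

Definition tprod T := \prod_(a <- T) minor X a.

Definition le_cols a b := [forall i, a i <= b i]%N.

Definition standard T := all (fun a => increasing a) T && sorted le_cols T.

Definition pure (n : nat) a := [forall i, a i < n]%N.

Lemma tprod_cat T1 T2 : tprod (T1 ++ T2) = tprod T1 * tprod T2.
Proof. exact: big_cat. Qed.

Lemma tprod_cons a T : tprod (a :: T) = minor X a * tprod T.
Proof. exact: big_cons. Qed.

Let K := (m * 2 ^ N).+1.

(** The ranks of the factors read as digits in base [K], the first factor being the most
    significant. Lexicographic descent at fixed length becomes descent of naturals. *)
Fixpoint tcolex T :=
  if T is a :: T' then (colex a * K ^ size T' + tcolex T')%N else 0%N.

Lemma colex_bound a : (colex a < K)%N.
Proof.
rewrite ltnS /colex -[m in (_ <= m * _)%N]card_ord -sum_nat_const.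
by apply: leq_sum => i _; rewrite leq_pexp2l // ltnW.
Qed.

Lemma tcolex_exchange T1 T2 a b a' b' : (colex a' < colex a)%N ->
  (tcolex (T1 ++ [:: a', b' & T2]) < tcolex (T1 ++ [:: a, b & T2]))%N.
Proof.
move=> h; elim: T1 => [|c T1 IH] /=; last by rewrite !size_cat /= ltn_add2l.
rewrite expnS; have := colex_bound b'; have := expn_gt0 K (size T2).
move: (K ^ _)%N (colex a) (colex a') (colex b') (colex b) (tcolex T2) h => x ca ca' cb' cb t.
rewrite /K /= => h x0 hb'.
have : (ca' * (K * x) + K * x <= ca * (K * x))%N by rewrite -mulSnr leq_mul2r h orbT.
have : (cb' * x + x <= K * x)%N by rewrite -mulSnr leq_mul2r hb' orbT.
by rewrite /K; move: (_ * x)%N => ? ; lia.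
Qed.

(** A factor with a repeated column vanishes. Any other is sorted at the cost of a sign, which keeps
    its set of columns, hence its rank and its purity. *)
Lemma increasing_tableau n r T : tprod T = 0 \/ exists T' (e : bool),
  [/\ all (fun a => increasing a) T', size T' = size T, tcolex T' = tcolex T,
      all (pure n) (take r T) -> all (pure n) (take r T') &
      tprod T = (-1) ^+ e * tprod T'].
Proof.
elim: T r => [|a T IH] r; first by right; exists [::], false; rewrite mul1r.
case: (boolP (injectiveb a)) => [/injectiveP inj_a|/injectiveP ninj]; last first.
  by left; rewrite tprod_cons minor_ninj ?mul0r.
case: (IH r.-1) => [T0|[T' [e [iT sT cT pT TE]]]].
  by left; rewrite tprod_cons T0 mulr0.
have [s is_] := increasing_perm inj_a.
right; exists ([ffun i => a (s i)] :: T'), ((s : bool) (+) e).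
have iE : increasing [ffun i => a (s i)].
  by apply/increasingP => i j ij; rewrite !ffunE; move/increasingP: is_; apply.
split=> /=.
- by rewrite iE.
- by rewrite sT.
- rewrite sT cT; congr (_ * _ + _)%N; rewrite -(colex_perm a s).
  by apply: eq_bigr => i _; rewrite ffunE.
- case: r pT => //= r pT /andP[/forallP pa /pT ->]; rewrite andbT.
  by apply/forallP => i; rewrite ffunE.
rewrite !tprod_cons TE (@eq_minor _ _ _ _ [ffun i => a (s i)] (a \o s)).
  rewrite minor_perm signr_addb -[LHS]mul1r.
  have mulE (u v x y : A) : u * u * (x * (v * y)) = u * v * (u * x * y) by ring.
  by rewrite -[RHS]mulE -signr_addb addbb.
by move=> i; rewrite ffunE.
Qed.

Lemma unsorted_split T : ~~ sorted le_cols T ->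
  exists T1 a b T2, T = T1 ++ [:: a, b & T2] /\ ~~ le_cols a b.
Proof.
case: T => // a T; elim: T a => //= b T IH a; rewrite negb_and.
case: (boolP (le_cols a b)) => [_ /= /IH[T1 [a' [b' [T2 [-> ?]]]]]|ab _].
  by exists (a :: T1), a', b', T2.
by exists [::], a, b, T.
Qed.

Definition std_prod n r x := exists T,
  [/\ standard T, (r <= size T)%N, all (pure n) (take r T) & x = tprod T].

(** Induction on [tcolex]. If consecutive factors have [b s < a s], exchanging the columns [b j]
    with [j <= s] into the first factor lowers its rank. Purity survives: the columns brought into a
    pure [a] are all below [a s < n]. *)
Lemma straightening n r T : (r <= size T)%N -> all (pure n) (take r T) ->
  span (std_prod n r) (tprod T).
Proof.
move: {2}(tcolex T).+1 (ltnSn (tcolex T)) => w; elim: w T => // w IHw T Tw rT pT.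
case: (increasing_tableau n r T) => [->|[T' [e [iT sT cT /(_ pT) pT' ->]]]].
  exact: span0.
have Ssg (c : bool) x : span (std_prod n r) x -> span (std_prod n r) ((-1) ^+ c * x).
  by move=> Sx; case: c; rewrite ?expr0 ?expr1 ?mul1r // mulN1r; apply: spanN.
apply: Ssg; rewrite -cT -sT in Tw rT.
case: (boolP (sorted le_cols T')) => [srt|/unsorted_split].
  by apply: span_gen; exists T'; split=> //; apply/andP.
move=> [T1 [a [b [T2 [TE]]]]]; rewrite negb_forall => /existsP[s].
rewrite -ltnNge => bs; rewrite {T' sT cT}TE in iT pT' Tw rT *.
move: iT; rewrite all_cat /= => /and4P[_ ia ib _].
have -> : tprod (T1 ++ [:: a, b & T2]) = tprod T1 * (minor X a * minor X b) * tprod T2.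
  by rewrite tprod_cat !tprod_cons !mulrA.
apply: (@minor_exchange _ _ _ X
  (fun x => span (std_prod n r) (tprod T1 * x * tprod T2)) a b (fun j => j <= s)%N).
- by rewrite mulr0 mul0r; apply: span0.
- by move=> x y; rewrite mulrDr mulrDl; apply: spanD.
- by move=> x; rewrite mulrN mulNr; apply: spanN.
move=> a' b' hb ha hb'.
case: (boolP (injectiveb (finfun a'))) => [/injectiveP inj'|/injectiveP ninj]; last first.
  rewrite minor_ninj ?mul0r ?mulr0 ?mul0r; first exact: span0.
  by move=> i'; apply: ninj => x y; rewrite !ffunE => /i'.
have {}inj' : injective a' by move=> x y e'; apply: inj'; rewrite !ffunE.
have bjs (j : 'I_m) : (j <= s)%N -> (b j < a s)%N.
  by move=> js; apply: leq_ltn_trans bs; apply: increasing_le.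
have minorE (c : 'I_m -> 'I_N) : minor X (finfun c) = minor X c.
  by apply: eq_minor => i; rewrite ffunE.
have -> : tprod T1 * (minor X a' * minor X b') * tprod T2 =
          tprod (T1 ++ [:: finfun a', finfun b' & T2]).
  by rewrite tprod_cat !tprod_cons !minorE !mulrA.
have ca : (colex (finfun a') < colex a)%N.
  rewrite (_ : colex (finfun a') = colex a'); last by apply: eq_bigr => i _; rewrite ffunE.
  exact: (@colex_exchange _ _ a b a' s).
apply: IHw.
- by rewrite -ltnS; apply: leq_trans Tw; rewrite ltnS; apply: tcolex_exchange.
- by move: rT; rewrite !size_cat.
have pa : pure n a -> pure n (finfun a').
  move=> /forallP pa; apply/forallP => i; rewrite ffunE.
  case: (ha i) => [[j ->]|[j js ->]]; first exact: pa.
  exact: ltn_trans (bjs j js) (pa s).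
have pb : pure n a -> pure n b -> pure n (finfun b').
  move=> /forallP pa' /forallP pb'; apply/forallP => i; rewrite ffunE.
  by case: (hb' i) => [[j ->]|[j ->]].
move: pT'; rewrite !take_cat; case: ifP => // _; rewrite !all_cat => /andP[->] /=.
(* Exactly one, or both, of the exchanged factors may lie among the first [r]; in the former case
   only [a'] has to be pure. *)
case: (r - size T1)%N => [|[|d]] //=; first by rewrite !andbT.
by move=> /and3P[/[dup] /pa -> /pb pb' /pb' -> ->].
Qed.

End Straightening.
(** * Leading monomials of standard tableaux *)

Lemma index_allpairs_pair (T1 T2 : eqType) (s1 : seq T1) (s2 : seq T2) x y :
  x \in s1 -> y \in s2 ->
  index (x, y) [seq (u, v) | u <- s1, v <- s2] = (index x s1 * size s2 + index y s2)%N.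
Proof.
elim: s1 => //= u s1 IH; rewrite inE index_cat size_map => xs ys.
have [->|ux] := eqVneq u x.
  by rewrite map_f // index_map ?mul0n // => v w [].
rewrite ifN; last by apply/mapP => -[v _ [e]]; rewrite e eqxx in ux.
by rewrite IH ?mulSn ?addnA //; move: xs; rewrite eq_sym (negbTE ux).
Qed.

(** Variables are numbered row by row; this makes the monomial order diagonal, that is, minors are
    led by their diagonal term. *)
Lemma val_mxvec_index m N (i : 'I_m) (j : 'I_N) : mxvec_index i j = (i * N + j)%N :> nat.
Proof.
rewrite /mxvec_index /=.
have rankE (T : finType) (x : T) : enum_rank x = index x (enum T) :> nat.
  by rewrite -{2}(enum_rankK x) /enum_val index_uniq ?enum_uniq // -cardE ltn_ord.
rewrite rankE enumT unlock /= /prod_enum.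
rewrite (index_allpairs_pair (mem_enum _ _) (mem_enum _ _)).
by rewrite !index_enum_ord size_enum_ord.
Qed.

Section LeadingMonomials.
Variables (k : fieldType) (m N : nat).
Implicit Types a b : 'I_m -> 'I_N.

Local Notation X := (generic_matrix k m N).

Definition diag_mnm a : 'X_{1..m * N} := (\sum_i U_(mxvec_index i (a i)))%MM.

Lemma mxvec_index_inj (i i' : 'I_m) (j j' : 'I_N) :
  (mxvec_index i j == mxvec_index i' j') = (i == i') && (j == j').
Proof.
apply/eqP/andP => [e|[/eqP -> /eqP -> //]].
have e' := congr1 (@nat_of_ord _) e; rewrite !val_mxvec_index in e'.
have ii : i = i'.
  apply: val_inj; have := ltn_ord j; have := ltn_ord j'; move: e' => /=.
  move: (nat_of_ord i) (nat_of_ord i') (nat_of_ord j) (nat_of_ord j') => x x' y y' e2 h h'.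
  have := congr1 (fun z => z %/ N)%N e2; rewrite !divnMDl ?(leq_ltn_trans _ h) //.
  by rewrite !divn_small // !addn0.
rewrite ii eqxx; split=> //; apply/eqP/val_inj => /=.
by move: e'; rewrite ii => /addnI.
Qed.

Lemma diag_mnmE a i j : diag_mnm a (mxvec_index i j) = (a i == j).
Proof.
rewrite /diag_mnm mnm_sumE (bigD1 i) //= mnm1E mxvec_index_inj eqxx /=.
rewrite big1 ?addn0 // => i' ne; by rewrite mnm1E mxvec_index_inj (negbTE ne).
Qed.

Lemma mdeg_diag_mnm a : mdeg (diag_mnm a) = m.
Proof.
rewrite /diag_mnm mdeg_sum (eq_bigr (fun=> 1%N)) => [|i _]; last by rewrite mdeg1.
by rewrite sum1_card card_ord.
Qed.

(** At the first index [i] moved by [s] one has [i < s i], hence [a i < a (s i)]. The first variable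
    with different exponents is then the one at [(i, a i)], which only the diagonal contains. *)
Lemma diag_mnm_lt a (s : 'S_m) : increasing a -> s != 1%g ->
  (diag_mnm (a \o s) < diag_mnm a)%O.
Proof.
move=> ia s1; apply/ltmcP; first by rewrite !mdeg_diag_mnm.
have [i1 hi1] : exists i, s i != i.
  apply/existsP; apply: contraNT s1; rewrite negb_exists => /forallP h.
  by apply/eqP/permP => i; rewrite perm1; apply/eqP; rewrite -[_ == _]negbK.
case: (@arg_minnP _ i1 (fun i => s i != i) (fun i => i : nat)) => // i si imin.
have sfix (j : 'I_m) : (j < i)%N -> s j = j.
  by move=> ji; apply/eqP; apply: contraLR ji => /imin; rewrite leqNgt.
have isi : (i < s i)%N.
  rewrite ltn_neqAle leqNgt; apply/andP; split.
    by apply: contraNneq si => e; apply/eqP/esym/val_inj.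
  apply/negP => /[dup] /sfix /perm_inj e; by rewrite e ltnn.
exists (mxvec_index i (a i)) => [l|]; last first.
  rewrite !diag_mnmE /= eqxx; case: eqP => // /(increasing_inj ia) e.
  by rewrite e eqxx in si.
case/mxvec_indexP: l => i' j'; rewrite !val_mxvec_index !diag_mnmE /= => lt.
have : (i' <= i)%N.
  rewrite leqNgt; apply/negP => ii; move: lt; rewrite ltnNge => /negP; apply.
  apply: leq_trans (_ : i.+1 * N <= _)%N.
    by rewrite mulSn addnC leq_add2r ltnW.
  by apply: leq_trans (leq_addr _ _); rewrite leq_mul2r ii orbT.
rewrite leq_eqVlt => /orP[/eqP/val_inj e|/sfix -> //].
rewrite e ltn_add2l in lt *.
have := ia => /increasingP/(_ _ _ isi) lt'.
case: eqP => [e1|_]; first by move: lt; rewrite -e1 ltnNge (ltnW lt').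
by case: eqP => [e1|_] //; move: lt; rewrite e1 ltnn.
Qed.

Lemma minorE a :
  minor X a = \sum_(s : 'S_m) (-1) ^+ s *: 'X_[k, diag_mnm (a \o s)].
Proof.
rewrite /minor /determinant; apply: eq_bigr => s _.
rewrite -mul_mpolyC rmorph_sign; congr (_ * _).
by rewrite /diag_mnm -mprodXE; apply: eq_bigr => i _; rewrite !mxE.
Qed.

Lemma mcoeff_minor_diag a : increasing a -> (minor X a)@_(diag_mnm a) = 1.
Proof.
move=> ia; rewrite minorE raddf_sum /= (bigD1 1%g) //= odd_perm1 expr0 scale1r.
rewrite mcoeffX (_ : diag_mnm (a \o (1%g : 'S_m)) = diag_mnm a) ?eqxx; last first.
  by apply: eq_bigr => i _; rewrite /= perm1.
rewrite big1 ?addr0 // => s s1; rewrite mcoeffZ mcoeffX.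
by rewrite lt_eqF ?mulr0 //; apply: diag_mnm_lt.
Qed.

Lemma minor_neq0 a : increasing a -> minor X a != 0.
Proof.
by move=> ia; apply/eqP => e; move: (mcoeff_minor_diag ia); rewrite e mcoeff0 => /eqP;
   rewrite eq_sym oner_eq0.
Qed.

Lemma mlead_minor a : increasing a -> mlead (minor X a) = diag_mnm a.
Proof.
move=> ia; apply/eqP; rewrite eq_le; apply/andP; split; last first.
  by apply: msupp_le_mlead; rewrite mcoeff_msupp mcoeff_minor_diag // oner_neq0.
have := mlead_supp (minor_neq0 ia); move: (mlead _) => u.
rewrite minorE => /msupp_sum_le /flattenP[l] /mapP[s _ ->] /msuppZ_le.
rewrite msuppX inE => /eqP ->.
have [->|s1] := eqVneq s 1%g; last exact/ltW/diag_mnm_lt.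
by rewrite (_ : diag_mnm _ = diag_mnm a) //; apply: eq_bigr => i _; rewrite /= perm1.
Qed.

Implicit Types T : seq {ffun 'I_m -> 'I_N}.

Definition tmnm T : 'X_{1..m * N} := (\sum_(a <- T) diag_mnm (fun_of_fin a))%MM.

Lemma mlead_tprod T : all (fun a : {ffun 'I_m -> 'I_N} => increasing a) T ->
  mlead (tprod X T) = tmnm T.
Proof.
move=> /allP iT; rewrite /tprod mlead_prod => [|a /iT ia _]; last exact: minor_neq0.
by rewrite /tmnm big_seq [RHS]big_seq; apply: eq_bigr => a /iT; apply: mlead_minor.
Qed.

Lemma tmnmE T i j : tmnm T (mxvec_index i j) =
  count_mem j [seq a i | a : {ffun 'I_m -> 'I_N} <- T].
Proof.
elim: T => [|a T IH]; first by rewrite /tmnm big_nil mnm0E.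
by rewrite /tmnm big_cons mnmDE diag_mnmE -/(tmnm T) IH.
Qed.

Lemma standard_sorted T i : standard T -> sorted (fun x y : 'I_N => x <= y)%N
  [seq a i | a : {ffun 'I_m -> 'I_N} <- T].
Proof.
move=> /andP[_]; rewrite sorted_map; apply: sub_sorted => a b /forallP; exact.
Qed.

(** The exponents in row [i] give the multiset of the [i]-th entries of the factors, and
    standardness says that these are listed in increasing order. A row must exist for the number of
    factors to be visible. *)
Lemma standard_mnm_inj T1 T2 : (0 < m)%N -> standard T1 -> standard T2 ->
  tmnm T1 = tmnm T2 -> T1 = T2.
Proof.
move=> m0 s1 s2 e.
have rowE i : [seq a i | a : {ffun 'I_m -> 'I_N} <- T1] =
              [seq a i | a : {ffun 'I_m -> 'I_N} <- T2].
  apply: (@sorted_eq _ (fun x y : 'I_N => x <= y)%N).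
  - by move=> y x z; apply: leq_trans.
  - by move=> x y /anti_leq; apply: val_inj.
  - exact: standard_sorted.
  - exact: standard_sorted.
  by apply/allP => j _; rewrite /= -!tmnmE e.
have sz : size T1 = size T2.
  by have := congr1 size (rowE (Ordinal m0)); rewrite !size_map.
have [a0|] := pickP {ffun 'I_m -> 'I_N}; last first.
  by case: T1 {s1 e rowE} sz => [|a ?]; [case: T2 {s2}|move=> _ /(_ a)].
move=> _; apply: (@eq_from_nth _ a0) => // l l1; apply/ffunP => i.
rewrite -(nth_map a0 (a0 i) (fun a : {ffun 'I_m -> 'I_N} => a i)) // rowE.
by rewrite (nth_map a0) // -sz.
Qed.

End LeadingMonomials.

Lemma bigjoin_mem n (T : eqType) (f : T -> 'X_{1..n}) (s : seq T) :
  s != [::] -> exists2 x, x \in s & (\join_(y <- s) f y)%O = f x.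
Proof.
elim: s => // a [|b s] IH _.
  by exists a; rewrite ?inE // big_seq1.
have [//|x xs e] := IH; rewrite big_cons e.
case: (leP (f a) (f x)) => [ax|/ltW xa].
  by exists x; [rewrite in_cons xs orbT|].
by exists a; [rewrite mem_head|].
Qed.

(** * Minors as non-zero-divisors on spans of standard products *)

Section NonZeroDivisor.
Variables (k : fieldType) (m N n : nat).

Local Notation X := (generic_matrix k m.+1 N).
Local Notation tableau := (seq {ffun 'I_m.+1 -> 'I_N}).
Implicit Types T : tableau.

Definition tspan (P : pred tableau) : {mpoly k[m.+1 * N]} -> Prop :=
  span (fun x => exists T, [/\ standard T, P T & x = tprod X T]).

Lemma tspan_seq P x : tspan P x -> exists l : seq (k * tableau),
  all (fun y => standard y.2 && P y.2) l /\ x = \sum_(y <- l) y.1 *: tprod X y.2.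
Proof.
elim=> [|c b y [T [sT PT ->]] _ [l [al ->]]].
  by exists [::]; rewrite big_nil.
by exists ((c, T) :: l); rewrite big_cons /= sT PT.
Qed.

(* Distinct standard tableaux have distinct leading monomials, so the largest of
   these cannot cancel. *)
Lemma mlead_tspan P x : tspan P x -> x != 0 ->
  exists T, [/\ standard T, P T & mlead x = tmnm T].
Proof.
move=> /tspan_seq[l [/allP al xE]] x0.
(* Coefficients of equal tableaux are collected and zero totals discarded, so [s] is duplicate-free
   with nonzero coefficients. *)
pose c T := \sum_(y <- l | y.2 == T) y.1.
pose s := [seq T <- undup (map snd l) | c T != 0].
have sP T : T \in s -> standard T && P T.
  by rewrite mem_filter mem_undup => /andP[_ /mapP[y /al h ->]].
have {}xE : x = \sum_(T <- s) c T *: tprod X T.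
  rewrite xE /s big_filter [RHS]big_mkcond /=.
  rewrite [RHS](eq_bigr (fun T => \sum_(y <- l | y.2 == T) y.1 *: tprod X y.2)); last first.
    move=> T _; transitivity (c T *: tprod X T); last first.
      by rewrite scaler_suml; apply: eq_bigr => y /eqP ->.
    by case: eqP => //= ->; rewrite scale0r.
  rewrite (exchange_big_dep predT) //= big_seq [RHS]big_seq; apply: eq_bigr => y yl.
  rewrite -big_filter (_ : filter _ _ = [:: y.2]) ?big_seq1 //.
  have := filter_pred1_uniq (undup_uniq (map snd l)) (_ : y.2 \in undup (map snd l)).
  rewrite mem_undup map_f // => <- //; apply: eq_filter => T; exact: eq_sym.
have mleadE T : T \in s -> mlead (c T *: tprod X T) = tmnm T.
  move=> Ts; have /andP[/andP[iT _] _] := sP _ Ts.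
  by move: Ts; rewrite mem_filter => /andP[cT _]; rewrite mleadZ // mlead_tprod.
have : mlead x = (\join_(T <- s) tmnm T)%O.
  rewrite xE mlead_sum /=.
    by rewrite big_seq [RHS]big_seq; apply: eq_bigr => T /mleadE.
  rewrite filter_predT (eq_in_map _ (@tmnm m.+1 N) s).1 // map_inj_in_uniq.
    by rewrite filter_uniq // undup_uniq.
  move=> T1 T2 /sP/andP[s1 _] /sP/andP[s2 _]; exact: standard_mnm_inj.
have [|T Ts ->] := bigjoin_mem (@tmnm m.+1 N) (s := s).
  by apply: contraNneq x0 => s0; rewrite xE s0 big_nil.
by exists T; have /andP[] := sP _ Ts; split.
Qed.

(* A minor whose last column is [>= n] does not contribute to the [pcount] of a
   leading monomial. *)
Definition pcount (u : 'X_{1..m.+1 * N}) :=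
  (\sum_(j < N | j < n) u (mxvec_index ord_max j))%N.

Lemma pcountD u v : pcount (u + v)%MM = (pcount u + pcount v)%N.
Proof. by rewrite /pcount -big_split /=; apply: eq_bigr => j _; rewrite mnmDE. Qed.

Lemma pcount_diag (a : 'I_m.+1 -> 'I_N) : pcount (diag_mnm a) = (a ord_max < n)%N.
Proof.
rewrite /pcount; case: ltnP => an.
  rewrite (bigD1 (a ord_max)) //= diag_mnmE eqxx big1 // => j /andP[_ ja].
  by rewrite diag_mnmE eq_sym (negbTE ja).
apply: big1 => j jn; rewrite diag_mnmE; case: eqP => // e.
by move: jn; rewrite -e ltnNge an.
Qed.

Lemma pcount_tmnm T :
  pcount (tmnm T) = count (fun a : {ffun 'I_m.+1 -> 'I_N} => a ord_max < n)%N T.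
Proof.
elim: T => [|a T IH].
  by rewrite /tmnm big_nil /pcount big1 // => j _; rewrite mnm0E.
by rewrite /tmnm big_cons pcountD pcount_diag -/(tmnm T) IH.
Qed.

Lemma pure_last (a : {ffun 'I_m.+1 -> 'I_N}) : increasing a ->
  pure n a = (a ord_max < n)%N.
Proof.
move=> ia; apply/forallP/idP => [//|an i]; apply: leq_ltn_trans an.
by apply: increasing_le => //; rewrite -ltnS.
Qed.

(** The last entries increase weakly along a standard tableau, so its pure factors come first, and
    [pcount] is their number. *)
Lemma standard_pcount r T : standard T ->
  (r <= size T)%N && all (pure n) (take r T) = (r <= pcount (tmnm T))%N.
Proof.
move=> /andP[]; rewrite pcount_tmnm; elim: T r => [|a T IH] [|r] //=.
move=> /andP[ia iT] pT; rewrite ltnS pure_last //.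
case: (boolP (a ord_max < n)%N) => [an|an] /=.
  by rewrite add1n ltnS; apply: IH => //; apply: path_sorted pT.
rewrite andbF (@eq_in_count _ _ pred0) ?count_pred0 // => b bT /=.
have /allP/(_ _ bT)/forallP/(_ ord_max) : all (le_cols a) T.
  apply: order_path_min pT => x y z /forallP xy /forallP yz.
  by apply/forallP => i; apply: leq_trans (yz i).
by move=> ab; apply: contraNF an; apply: leq_ltn_trans.
Qed.

Definition min_pure r T := (r <= pcount (tmnm T))%N.

(** This plays the role of [I^r] inside the algebra of maximal minors; for [r = 0] it is that whole
    algebra. *)
Definition pure_span r := span (fun x => exists T1 T2,
  [/\ size T1 = r, all (pure n) T1 & x = tprod X T1 * tprod X T2]).

Lemma pure_spanE r x : pure_span r x <-> tspan (min_pure r) x.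
Proof.
split.
  apply: span_span => _ [T1 [T2 [s1 p1 ->]]]; rewrite -tprod_cat.
  apply: sub_span (straightening (n := n) (r := r) X _ _).
  - move=> _ [T [sT rT pT ->]]; exists T; split=> //.
    by rewrite /min_pure -standard_pcount // rT.
  - by rewrite size_cat s1 leq_addr.
  - by rewrite -s1 take_size_cat.
apply: sub_span => b [T [sT]]; rewrite /min_pure -standard_pcount // => /andP[rT pT] ->.
exists (take r T), (drop r T); split=> //; last by rewrite -tprod_cat cat_take_drop.
by rewrite size_take; case: ltngtP rT.
Qed.

Lemma pure_spanM r s x y : pure_span r x -> pure_span s y -> pure_span (r + s) (x * y).
Proof.
apply: span_mul => _ _ [T1 [T2 [s1 p1 ->]]] [T3 [T4 [s3 p3 ->]]].
exists (T1 ++ T3), (T2 ++ T4); split; first by rewrite size_cat s1 s3.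
  by rewrite all_cat p1.
by rewrite !tprod_cat mulrACA.
Qed.

Lemma pure_span_minor (a : 'I_m.+1 -> 'I_N) : pure_span 0 (minor X a).
Proof.
apply: span_gen; exists [::], [:: finfun a]; split=> //.
rewrite tprod_cons /tprod !big_nil mul1r mulr1.
by apply: eq_minor => i; rewrite ffunE.
Qed.

Lemma pure_span_pure (a : 'I_m.+1 -> 'I_N) :
  (forall i, a i < n)%N -> pure_span 1 (minor X a).
Proof.
move=> an; apply: span_gen; exists [:: finfun a], [::]; split=> //=.
  by rewrite andbT; apply/forallP => i; rewrite ffunE.
rewrite tprod_cons /tprod !big_nil !mulr1.
by apply: eq_minor => i; rewrite ffunE.
Qed.

(** Split the standard expansion of [F] into tableaux with at least [r] pure factors ([F1]) and the
    others ([F2]). If [F2] were nonzero, its leading monomial would have [pcount] below [r], and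
    multiplying by [minor X d] would not change that, although the product lies in [pure_span r]. *)
Lemma minor_nzd r (d : 'I_m.+1 -> 'I_N) F : increasing d -> (n <= d ord_max)%N ->
  pure_span 0 F -> pure_span r (minor X d * F) -> pure_span r F.
Proof.
move=> id dn /pure_spanE/tspan_seq[l [al FE]] dF.
pose F1 := \sum_(y <- l | min_pure r y.2) y.1 *: tprod X y.2.
pose F2 := \sum_(y <- l | ~~ min_pure r y.2) y.1 *: tprod X y.2.
have {}FE : F = F1 + F2 by rewrite FE (bigID (fun y => min_pure r y.2)).
have sum_span (Q : pred tableau) :
    tspan Q (\sum_(y <- l | Q y.2) y.1 *: tprod X y.2).
  rewrite big_seq_cond; apply: big_ind; [exact: span0|exact: spanD|].
  move=> y /andP[yl Qy]; apply/spanZ/span_gen; exists y.2; split=> //.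
  by have /andP[] := allP al _ yl.
have F1r : pure_span r F1 by apply/pure_spanE/sum_span.
suff F20 : F2 = 0 by rewrite FE F20 addr0.
apply/eqP; apply/negP => /negP F2n0.
have [T [sT Tr ldT]] := mlead_tspan (sum_span (predC (min_pure r))) F2n0.
have : pure_span r (minor X d * F2).
  have -> : minor X d * F2 = minor X d * F - minor X d * F1.
    by rewrite FE mulrDr addrC addKr.
  by apply: spanD => //; apply/spanN/(@pure_spanM 0 r) => //; apply: pure_span_minor.
move=> /pure_spanE /mlead_tspan[|T' [_ T'r]].
  by rewrite mulf_neq0 // minor_neq0.
rewrite mleadM ?minor_neq0 // mlead_minor // ldT => /(congr1 pcount).
rewrite pcountD pcount_diag ltnNge dn add0n => e.
by move: Tr; rewrite /= /min_pure e -/(min_pure r T') T'r.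
Qed.

End NonZeroDivisor.
(** * Powers of the ideal of maximal minors *)

Section IdealPowers.
Variable R : comNzRingType.
Implicit Types (S J a b : R -> Prop).

Lemma gen_ideal_ideal S : is_ideal (gen_ideal S).
Proof.
split=> [J [J0 _] //|]; split=> [x y hx hy J hJ SJ|r x hx J hJ SJ].
  by have [_ [JD _]] := hJ; apply: JD; [apply: hx|apply: hy].
by have [_ [_ JM]] := hJ; apply: JM; apply: hx.
Qed.

Lemma gen_idealS S x : S x -> gen_ideal S x.
Proof. by move=> Sx J _; apply. Qed.

Lemma ideal0 J : is_ideal J -> J 0.
Proof. by case. Qed.

Lemma idealD J x y : is_ideal J -> J x -> J y -> J (x + y).
Proof. by case=> _ [h _]; apply: h. Qed.

Lemma idealMl J r x : is_ideal J -> J x -> J (r * x).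
Proof. by case=> _ [_ h]; apply: h. Qed.

Lemma idealMr J r x : is_ideal J -> J x -> J (x * r).
Proof. by rewrite mulrC; apply: idealMl. Qed.

Lemma ideal_sum J (T : eqType) (s : seq T) (P : pred T) (F : T -> R) :
  is_ideal J -> (forall x, x \in s -> P x -> J (F x)) -> J (\sum_(x <- s | P x) F x).
Proof.
move=> hJ h; rewrite big_seq_cond; apply: big_ind.
- exact: ideal0.
- by move=> x y; apply: idealD.
- by move=> x /andP[]; apply: h.
Qed.

Lemma ideal_colon J z : is_ideal J -> is_ideal (fun x => J (x * z)).
Proof.
move=> hJ; split; first by rewrite mul0r; apply: ideal0.
split=> [x y|r x]; first by rewrite mulrDl; apply: idealD.
by rewrite -mulrA; apply: idealMl.
Qed.

Lemma ideal_pow_ideal a r : is_ideal (ideal_pow a r).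
Proof. exact: gen_ideal_ideal. Qed.

Lemma ideal_pow0 a x : ideal_pow a 0 x.
Proof.
rewrite -[x]mulr1; apply: (idealMl _ (ideal_pow_ideal a 0)).
by apply: gen_idealS; exists [::]; rewrite big_nil.
Qed.

Lemma ideal_pow_prod a (T : eqType) (s : seq T) (F : T -> R) r :
  size s = r -> (forall x, x \in s -> a (F x)) -> ideal_pow a r (\prod_(x <- s) F x).
Proof.
move=> sr h; apply: gen_idealS; exists (map F s); rewrite size_map big_map; split=> //.
by split=> // _ /mapP[x /h ax ->].
Qed.

Lemma ideal_pow_exp a x r : a x -> ideal_pow a r (x ^+ r).
Proof.
move=> ax; have := @ideal_pow_prod a _ (nseq r x) id r (size_nseq _ _).
rewrite big_nseq; have -> : iter r ( *%R x) 1 = x ^+ r.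
  by elim: r => //= r ->; rewrite exprS.
by apply=> y /nseqP[-> _].
Qed.

Lemma ideal_powM a r s x y :
  ideal_pow a r x -> ideal_pow a s y -> ideal_pow a (r + s) (x * y).
Proof.
have hJ := ideal_pow_ideal a (r + s).
move=> xr ys.
apply: (xr (fun x => ideal_pow a (r + s) (x * y))); first exact: ideal_colon.
move=> _ [t [tr [ta ->]]]; rewrite mulrC.
apply: (ys (fun y => ideal_pow a (r + s) (y * \prod_(z <- t) z))); first exact: ideal_colon.
move=> _ [u [us [ua ->]]]; rewrite mulrC -big_cat /=; apply: ideal_pow_prod.
  by rewrite size_cat tr us.
by move=> z; rewrite mem_cat => /orP[/ta|/ua].
Qed.

Lemma ideal_pow_le a r s x : (r <= s)%N -> ideal_pow a s x -> ideal_pow a r x.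
Proof.
move=> rs; apply; first exact: ideal_pow_ideal.
move=> _ [t [ts [ta ->]]]; rewrite -(cat_take_drop r t) big_cat /= mulrC.
apply: (idealMl _ (ideal_pow_ideal a r)).
apply: ideal_pow_prod => [|y /mem_take]; last exact: ta.
by rewrite size_take ts; case: ltngtP rs.
Qed.

Lemma ideal_pow_gen S r J : is_ideal J ->
  (forall s, size s = r -> (forall y, y \in s -> S y) -> J (\prod_(y <- s) y)) ->
  Defs.subset (ideal_pow (gen_ideal S) r) J.
Proof.
move=> hJ h x; apply=> // _ [s [sr [sS ->]]].
(* Factors pass one at a time from [s], in the generated ideal, to [t], which consists of
   generators. *)
suff: forall t, (forall y, y \in t -> S y) -> (size s + size t)%N = r ->
   J (\prod_(y <- s) y * \prod_(y <- t) y).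
  by move=> /(_ [::]); rewrite big_nil mulr1 addn0; apply.
move=> {sr}; elim: s sS => [_|y s IH sS] t tS st.
  by rewrite big_nil mul1r; apply: h.
rewrite big_cons -mulrA.
apply: (sS y (mem_head _ _) (fun y => J (y * _))); first exact: ideal_colon.
move=> z Sz; rewrite mulrCA.
have -> : z * \prod_(u <- t) u = \prod_(u <- z :: t) u by rewrite big_cons.
apply: IH.
- by move=> u us; apply: sS; rewrite in_cons us orbT.
- by move=> u; rewrite in_cons => /orP[/eqP ->|/tS].
by rewrite -st /= addnS addSn.
Qed.

Lemma frob_pow_ideal b q : is_ideal (frob_pow b q).
Proof. exact: gen_ideal_ideal. Qed.

Lemma frob_powX b q x : b x -> frob_pow b q (x ^+ q).
Proof. by move=> bx; apply: gen_idealS; exists x. Qed.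

End IdealPowers.

(** * Substitution of a matrix for the generic matrix *)

Section Substitution.
Variables (k : fieldType) (m n l : nat) (M : 'M[{mpoly k[l]}]_(m, n)).

Definition mxsubst : {mpoly k[m * n]} -> {mpoly k[l]} :=
  comp_mpoly [tuple mxvec M 0 i | i < m * n].

HB.instance Definition _ := GRing.RMorphism.copy mxsubst
  (comp_mpoly [tuple mxvec M 0 i | i < m * n]).

Lemma mxsubst_generic : map_mx mxsubst (generic_matrix k m n) = M.
Proof.
apply/matrixP => i j; rewrite !mxE /mxsubst comp_mpolyXU -tnth_nth tnth_mktuple.
by rewrite mxvecE.
Qed.

Lemma mxsubst_minor a : mxsubst (minor (generic_matrix k m n) a) = minor M a.
Proof.
rewrite /minor -det_map_mx; congr (\det _); apply/matrixP => i j.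
by rewrite mxE [in LHS]mxE -[in RHS]mxsubst_generic [RHS]mxE [RHS]mxE.
Qed.

Lemma mxsubstZ c p : mxsubst (c *: p) = c *: mxsubst p.
Proof. exact: comp_mpolyZ. Qed.

Lemma mxsubstE f :
  mxsubst f = \sum_(u <- msupp f) f@_u *: \prod_i mxvec M 0 i ^+ u i.
Proof.
rewrite /mxsubst comp_mpolyEX; apply: eq_bigr => u _; rewrite comp_mpolyX.
by congr (_ *: _); apply: eq_bigr => i _; rewrite tnth_mktuple.
Qed.

Lemma mxsubst_ind (P : {mpoly k[l]} -> Prop) :
  P 0 -> (forall x y, P x -> P y -> P (x + y)) -> (forall c x, P x -> P (c *: x)) ->
  P 1 -> (forall x y, P x -> P y -> P (x * y)) -> (forall i j, P (M i j)) ->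
  forall f, P (mxsubst f).
Proof.
move=> P0 PD PZ P1 PM PMx f; rewrite mxsubstE.
apply: big_ind => // u _; apply: PZ; apply: big_ind => // i _.
have Pi : P (mxvec M 0 i) by case/mxvec_indexP: i => a b; rewrite mxvecE.
by elim: (u i) => [|e IH]; rewrite ?expr0 // exprS; apply: PM.
Qed.

End Substitution.

Lemma minor_mulmx (R : comNzRingType) m n (A : 'M[R]_m) (B : 'M[R]_(m, n)) a :
  minor (A *m B) a = \det A * minor B a.
Proof.
rewrite /minor -det_mulmx; congr (\det _); apply/matrixP => i j.
by rewrite !mxE; apply: eq_bigr => l _; rewrite !mxE.
Qed.

Lemma minor_maximal (k : fieldType) m n a :
  maximal_minors_ideal k m n (minor (generic_matrix k m n) a).
Proof.
have hI : is_ideal (maximal_minors_ideal k m n) by exact: gen_ideal_ideal.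
case: (boolP (injectiveb (finfun a))) => [/injectiveP inj'|/injectiveP ninj]; last first.
  rewrite minor_ninj; first exact: ideal0.
  by move=> i'; apply: ninj => x y; rewrite !ffunE => /i'.
have inj_a : injective a by move=> x y e'; apply: inj'; rewrite !ffunE.
have [s /increasingP is_] := increasing_perm inj_a.
have -> : minor (generic_matrix k m n) a =
    (-1) ^+ s * minor (generic_matrix k m n) (a \o s).
  by rewrite minor_perm mulrA -signr_addb addbb mul1r.
by apply: (idealMl _ hI); apply: gen_idealS; exists (a \o s).
Qed.

(** * Cancelling the corner minor modulo powers of [I] *)

Section MinorsNonZeroDivisor.
Variables (k : fieldType) (m n : nat) (hmn : (m.+1 <= n)%N).

Local Notation X := (generic_matrix k m.+1 n).
Local Notation I := (maximal_minors_ideal k m.+1 n).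
Local Notation Z := (generic_matrix k m.+1 (n + m.+1)).
Local Notation Y := (rsubmx Z).
Local Notation psi := (mxsubst (\adj Y *m lsubmx Z)).
Local Notation theta := (mxsubst (row_mx X 1%:M)).
Local Notation pspan := (@pure_span k m (n + m.+1) n).

(** The last column is a unit vector, so the determinant is the minor [c] of the overview, of size
    [m] as there are [m.+1] rows. The square form lets [psi] be computed by matrix products. *)
Definition corner_mx : 'M[{mpoly k[m.+1 * n]}]_m.+1 :=
  \matrix_(i, j) if (j < m)%N then X i (widen_ord hmn j) else (i == ord_max)%:R.

Definition corner := \det corner_mx.

Lemma det_Y : \det Y = minor Z (@rshift n m.+1).
Proof. by congr (\det _); apply/matrixP => i j; rewrite !mxE. Qed.

Lemma increasing_rshift : increasing (@rshift n m.+1).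
Proof. by apply/increasingP => i j ij /=; rewrite ltn_add2l. Qed.

Lemma det_adj_Y : \det (\adj Y) = \det Y ^+ m.
Proof.
have Y0 : \det Y != 0 by rewrite det_Y minor_neq0 // increasing_rshift.
apply: (mulfI Y0); rewrite -exprS -det_mulmx mul_mx_adj.
by rewrite det_scalar.
Qed.

(** Cramer's rule: the entry [(i, j)] of [\adj Y *m lsubmx Z] is the maximal minor of [Z] on the
    columns of [Y], with the [i]-th one replaced by column [j] of the left block. *)
Lemma pspan_psi f : pspan 0 (psi f).
Proof.
have pspan1 : pspan 0 1.
  by apply: span_gen; exists [::], [::]; rewrite /tprod !big_nil mulr1.
apply: mxsubst_ind => //; [exact: span0|exact: spanD|exact: spanZ|..].
  exact: (@pure_spanM _ _ _ _ 0 0).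
move=> i j.
pose a (c : 'I_m.+1) := if c == i then lshift m.+1 j else rshift n c.
have -> : (\adj Y *m lsubmx Z) i j = minor Z a.
  rewrite /minor (expand_det_col _ i) mxE; apply: eq_bigr => l _.
  rewrite [X in _ = X * _]mxE /a eqxx mulrC; congr (_ * _); first by rewrite mxE.
  rewrite [LHS]mxE /cofactor; congr (_ * \det _); apply/matrixP => u v.
  by rewrite !mxE eq_sym (negbTE (neq_lift _ _)).
exact: pure_span_minor.
Qed.

Lemma det_Y_pspan e : pspan 0 (\det Y ^+ e).
Proof.
elim: e => [|e IH].
  by apply: span_gen; exists [::], [::]; rewrite /tprod !big_nil mulr1.
rewrite exprS; apply: (@pure_spanM _ _ _ _ 0 0) => //.
by rewrite det_Y; apply: pure_span_minor.
Qed.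

Lemma psi_minor a : pspan 1 (psi (minor X a)).
Proof.
rewrite mxsubst_minor minor_mulmx det_adj_Y.
apply: (@pure_spanM _ _ _ _ 0 1); first exact: det_Y_pspan.
have -> : minor (lsubmx Z) a = minor Z (@lshift n m.+1 \o a).
  by congr (\det _); apply/matrixP => i j; rewrite !mxE.
by apply: pure_span_pure => i /=.
Qed.

Lemma psi_ideal_pow r f : ideal_pow I r f -> pspan r (psi f).
Proof.
apply: (@ideal_pow_gen _ _ r (fun f => pspan r (psi f))).
  split; first by rewrite rmorph0; apply: span0.
  split=> [x y hx hy|x y hy]; first by rewrite rmorphD; apply: spanD.
  by rewrite rmorphM; apply: (@pure_spanM _ _ _ _ 0 r) => //; apply: pspan_psi.
move=> s <- {r}; elim: s => [|x s IH] hs.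
  by rewrite big_nil rmorph1; apply: (det_Y_pspan 0).
rewrite big_cons rmorphM /=; apply: (@pure_spanM _ _ _ _ 1); last first.
  by apply: IH => y ys; apply: hs; rewrite in_cons ys orbT.
by have [a [_ ->]] := hs x (mem_head _ _); apply: psi_minor.
Qed.

Definition corner_cols (j : 'I_m.+1) : 'I_(n + m.+1) :=
  if (j < m)%N then lshift m.+1 (widen_ord hmn j) else rshift n ord_max.

Lemma increasing_corner_cols : increasing corner_cols.
Proof.
apply/increasingP => i j ij; rewrite /corner_cols.
have -> : (i < m)%N by apply: leq_trans ij _; rewrite -ltnS.
by case: ifP => _ //=; apply: ltn_addr; apply: leq_trans hmn.
Qed.

(** Scaling the last column of the image of [corner_mx] by [\det Y] gives the last column of
    [\adj Y *m Y]. The result is [\adj Y] times the submatrix of [Z] on [corner_cols]. *)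
Lemma psi_corner :
  psi corner * \det Y = \det Y ^+ m * minor Z corner_cols.
Proof.
pose D := \row_(j < m.+1) if (j < m)%N then 1 else \det Y.
have detD : \det (diag_mx D) = \det Y.
  rewrite det_diag big_ord_recr /= !mxE ltnn big1 ?mul1r // => i _.
  by rewrite mxE /= ltn_ord.
rewrite -{1}detD -det_adj_Y -det_map_mx -!det_mulmx; congr (\det _).
rewrite mul_mx_diag; apply/matrixP => i j; rewrite [LHS]mxE [X in X * _]mxE [corner_mx i j]mxE.
rewrite [X in _ * X]mxE [RHS]mxE; case: ifPn => jm.
  rewrite mulr1.
  have /matrixP/(_ i (widen_ord hmn j)) := mxsubst_generic (\adj Y *m lsubmx Z).
  rewrite [LHS]mxE => e; rewrite [LHS]e mxE; apply: eq_bigr => l _; congr (_ * _).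
  by rewrite !mxE /corner_cols jm.
have /matrixP/(_ i ord_max) := mul_adj_mx Y.
rewrite [RHS]mxE => /esym; rewrite rmorph_nat mulr_natl => ->.
rewrite mxE; apply: eq_bigr => l _; congr (_ * _).
by rewrite !mxE /corner_cols (negbTE jm).
Qed.

(** [theta] specializes [Z] to [[X | 1]], and the adjugate of the identity is the identity. *)
Lemma theta_psi f : theta (psi f) = f.
Proof.
have thZ : map_mx theta Z = row_mx X 1%:M by apply: mxsubst_generic.
have thpsi : map_mx theta (\adj Y *m lsubmx Z) = X.
  rewrite map_mxM map_mx_adj map_rsubmx map_lsubmx thZ row_mxKr row_mxKl.
  by rewrite adj1 mul1mx.
rewrite (mxsubstE _ f) rmorph_sum [RHS]mpolyE; apply: eq_bigr => u _.
rewrite /= mxsubstZ rmorph_prod mpolyXE_id; congr (_ *: _).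
apply: eq_bigr => i _; rewrite rmorphXn; congr (_ ^+ _).
case/mxvec_indexP: i => a b; rewrite mxvecE.
by move/matrixP: thpsi => /(_ a b); rewrite !mxE.
Qed.

Lemma theta_pspan r x : pspan r x -> ideal_pow I r (theta x).
Proof.
have hJ := ideal_pow_ideal I r.
move: x; apply: span_closed => [|x y hx hy|c x hx|x [T1 [T2 [s1 p1 ->]]]].
- by rewrite rmorph0; apply: (ideal0 hJ).
- by rewrite rmorphD; apply: (idealD hJ).
- by rewrite mxsubstZ -mul_mpolyC; apply: (idealMl _ hJ).
rewrite rmorphM; apply: (idealMr _ hJ) => //; rewrite /tprod rmorph_prod.
apply: ideal_pow_prod => // a aT; rewrite /= mxsubst_minor.
have /forallP an := allP p1 _ aT.
have -> : minor (row_mx X 1%:M) a = minor X (fun i => Ordinal (an i)).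
  congr (\det _); apply/matrixP => i j; rewrite [LHS]mxE [RHS]mxE.
  rewrite -(row_mxEl X 1%:M); congr (row_mx _ _ _ _); exact: val_inj.
exact: minor_maximal.
Qed.

Lemma det_Y_nzd r e F : pspan 0 F -> pspan r (\det Y ^+ e * F) -> pspan r F.
Proof.
move=> F0; elim: e => [|e IH]; first by rewrite expr0 mul1r.
rewrite exprS -mulrA {1}det_Y => h; apply: IH.
apply: minor_nzd h; first exact: increasing_rshift; first exact: leq_addr.
by apply: (@pure_spanM _ _ _ _ 0 0) => //; apply: det_Y_pspan.
Qed.

(** Apply [psi] and multiply by [\det Y] to use [psi_corner]. The factors [\det Y] and
    [minor Z corner_cols] both end in a column of [Y], so they can be cancelled; [theta] then
    returns to the original ring. *)
Lemma corner_nzd r f : ideal_pow I r (corner * f) -> ideal_pow I r f.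
Proof.
move=> /psi_ideal_pow; rewrite rmorphM /= => h.
have {}h : pspan r (\det Y ^+ m * (minor Z corner_cols * psi f)).
  rewrite mulrA -psi_corner mulrAC mulrC.
  by apply: (@pure_spanM _ _ _ _ 0 r) => //; rewrite det_Y; apply: pure_span_minor.
have {}h : pspan r (minor Z corner_cols * psi f).
  apply: det_Y_nzd h; apply: (@pure_spanM _ _ _ _ 0 0); last exact: pspan_psi.
  exact: pure_span_minor.
have {}h : pspan r (psi f).
  apply: minor_nzd h; [exact: increasing_corner_cols| |exact: pspan_psi].
  by rewrite /corner_cols ltnn /= leq_addr.
by rewrite -[f]theta_psi; apply: theta_pspan.
Qed.

Lemma corner_exp_nzd r e f : ideal_pow I r (corner ^+ e * f) -> ideal_pow I r f.
Proof.
elim: e => [|e IH]; first by rewrite expr0 mul1r.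
by rewrite exprS -mulrA => /corner_nzd.
Qed.

End MinorsNonZeroDivisor.
(** * Frobenius powers over an arbitrary field *)

Section Frobenius.
Variables (k : fieldType) (p : nat) (hp : p \in [pchar k]) (e : nat).
Local Notation q := (p ^ e)%N.

Lemma pexp_gt0 : (0 < q)%N.
Proof. by rewrite expn_gt0 prime_gt0 // (pcharf_prime hp). Qed.

Lemma pexp_pnat (A : comAlgType k) : [pchar A].-nat q.
Proof.
rewrite pnatX (eq_pnat _ (pchar_lalg A)) pnatE ?(pcharf_prime hp) //.
by rewrite hp.
Qed.

Definition frobk of p \in [pchar k] := fun x : k => x ^+ q.

Lemma frobk_zmod : zmod_morphism (frobk hp).
Proof.
move=> x y; rewrite /frobk -[in LHS](subrK y x) addrK.
by apply: (@addIr _ (y ^+ q)); rewrite subrK -(exprDn_pchar _ _ (pexp_pnat k^o)) subrK.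
Qed.

Lemma frobk_monoid : monoid_morphism (frobk hp).
Proof. by split=> [|x y]; rewrite /frobk ?expr1n ?exprMn. Qed.

HB.instance Definition _ := GRing.isZmodMorphism.Build k k (frobk hp) frobk_zmod.
HB.instance Definition _ := GRing.isMonoidMorphism.Build k k (frobk hp) frobk_monoid.

Variable L : nat.
Local Notation R := {mpoly k[L]}.
Local Notation sig := (map_mpoly (frobk hp)).

(** Frobenius is factored as [sig] on coefficients followed by [frobX] on variables. The ring is
    free over the image of [frobX] on the monomials with exponents below [q], whatever [k] is, so no
    basis of [k] over its [q]-th powers is chosen. *)
Definition frobX : R -> R := comp_mpoly [tuple 'X_i ^+ q | i < L].

HB.instance Definition _ := GRing.RMorphism.copy frobX (comp_mpoly [tuple 'X_i ^+ q | i < L]).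

Lemma frobX_mnm (u : 'X_{1..L}) : frobX 'X_[u] = 'X_[(u *+ q)%MM].
Proof.
rewrite /frobX comp_mpolyX mpolyXE_id; apply: eq_bigr => i _.
by rewrite tnth_mktuple mulmnE -exprM mulnC.
Qed.

Lemma frobXZ c (g : R) : frobX (c *: g) = c *: frobX g.
Proof. exact: comp_mpolyZ. Qed.

Lemma frob_mpoly (g : R) : g ^+ q = frobX (sig g).
Proof.
elim/mpolyind: g => [|c u g _ _ IH].
  by rewrite !rmorph0 expr0n; case: (p ^ e)%N pexp_gt0.
rewrite (exprDn_pchar _ _ (pexp_pnat R)) IH rmorphD /= [RHS]rmorphD /=; congr (_ + _).
by rewrite map_mpolyZ map_mpolyX frobXZ frobX_mnm exprZn mpolyXn.
Qed.

(* If [g = \sum_u 'X_[u] * frobX g_u], with [u] ranging over the exponents with all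
   entries [< q], then [frob_part u g = g_u]. *)
Definition frob_part (u : 'X_{1..L}) (g : R) : R :=
  \sum_(w : 'X_{1..L < msize g}) g@_(w *+ q + u)%MM *: 'X_[w].

Lemma mcoeff_frob_part u g w : (frob_part u g)@_w = g@_(w *+ q + u)%MM.
Proof.
rewrite /frob_part; case: (ltnP (mdeg w) (msize g)) => wg.
  exact: (@mcoeff_mpoly _ _ (fun w => g@_(w *+ q + u)%MM)).
rewrite raddf_sum /= big1 => [|v _].
  apply/esym/memN_msupp_eq0/msize_mdeg_ge; apply: leq_trans wg _.
  by rewrite mdegD mdegMn (leq_trans _ (leq_addr _ _)) // leq_pmulr // pexp_gt0.
rewrite mcoeffZ mcoeffX; case: eqP => [vw|]; last by rewrite mulr0.
by move: (bmdeg v); rewrite vw ltnNge wg.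
Qed.

Lemma frob_part0 u : frob_part u 0 = 0.
Proof. by apply/mpolyP => w; rewrite mcoeff_frob_part !mcoeff0. Qed.

Lemma frob_partD u : {morph frob_part u : g h / g + h}.
Proof. by move=> g h; apply/mpolyP => w; rewrite mcoeffD !mcoeff_frob_part mcoeffD. Qed.

Lemma frob_partZ u c g : frob_part u (c *: g) = c *: frob_part u g.
Proof. by apply/mpolyP => w; rewrite mcoeffZ !mcoeff_frob_part mcoeffZ. Qed.

Lemma frob_part_sig u g : frob_part u (sig g) = sig (frob_part u g).
Proof.
by apply/mpolyP => w; rewrite mcoeff_frob_part !mcoeff_map_mpoly /= mcoeff_frob_part.
Qed.

Lemma mcoeffMX_nle (f : R) (v w : 'X_{1..L}) :
  ~~ (v <= w)%MM -> (f * 'X_[v])@_w = 0.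
Proof.
move=> vw; apply: memN_msupp_eq0; rewrite (perm_mem (msuppMX f v)).
by apply: contra vw => /mapP[u _ ->]; apply: lem_addr.
Qed.

Lemma frob_partM (u : 'X_{1..L}) g f : (forall i, u i < q)%N ->
  frob_part u (frobX g * f) = g * frob_part u f.
Proof.
move=> uq; elim/mpolyind: g => [|c v g _ _ IH].
  by rewrite rmorph0 !mul0r frob_part0.
rewrite rmorphD /= !mulrDl frob_partD IH; congr (_ + _).
rewrite frobXZ -!scalerAl frob_partZ frobX_mnm; congr (_ *: _).
apply/mpolyP => w; rewrite mcoeff_frob_part [_ * f]mulrC [_ * frob_part u f]mulrC.
case: (boolP (v <= w)%MM) => vw.
  have -> : w = (v + (w - v))%MM by rewrite addmC submK.
  move: (w - v)%MM => z; rewrite mcoeffMX mcoeff_frob_part.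
  have -> : ((v + z) *+ q + u = v *+ q + (z *+ q + u))%MM.
    by apply/mnmP => i; rewrite !(mnmDE, mulmnE) mulnDl addnA.
  by rewrite mcoeffMX.
(* Since the entries of [u] are below [q], [v q <= w q + u] forces [v <= w]; otherwise both
   coefficients vanish. *)
rewrite !mcoeffMX_nle //; apply: contra vw => /mnm_lepP h; apply/mnm_lepP => i.
have := h i; rewrite !(mnmDE, mulmnE) => hi; rewrite -ltnS.
rewrite -(ltn_pmul2r pexp_gt0); apply: leq_ltn_trans hi _.
by rewrite mulSn addnC ltn_add2r.
Qed.

Definition digits (u : {ffun 'I_L -> 'I_q}) : 'X_{1..L} := [multinom u i : nat | i < L].

(** Euclidean division of every exponent by [q]: a monomial has a single nonzero part, at its vector
    of remainders. *)
Lemma frob_part_expand (f : R) :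
  f = \sum_(u : {ffun 'I_L -> 'I_q}) 'X_[digits u] * frobX (frob_part (digits u) f).
Proof.
elim/mpolyind: f => [|c v f _ _ {1}->].
  by rewrite big1 // => u _; rewrite frob_part0 rmorph0 mulr0.
under [in RHS]eq_bigr do rewrite frob_partD rmorphD mulrDr.
rewrite big_split /=; congr (_ + _).
under eq_bigr do rewrite frob_partZ frobXZ -scalerAr.
rewrite -scaler_sumr; congr (_ *: _).
pose u0 : {ffun 'I_L -> 'I_q} := [ffun i => Ordinal (ltn_pmod (v i) pexp_gt0)].
pose w0 : 'X_{1..L} := [multinom v i %/ q | i < L].
have partX (u : {ffun 'I_L -> 'I_q}) :
    frob_part (digits u) 'X_[v] = if u == u0 then 'X_[w0] else 0.
  apply/mpolyP => w; rewrite mcoeff_frob_part mcoeffX.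
  have -> : (v == w *+ q + digits u)%MM = (u == u0) && (w0 == w).
    apply/eqP/andP => [/mnmP h|[/eqP -> /eqP <-]].
      split; first apply/eqP/ffunP => i.
        apply: val_inj; rewrite ffunE /= h !(mnmDE, mulmnE, mnmE).
        by rewrite modnMDl modn_small.
      apply/eqP/mnmP => i; rewrite mnmE h !(mnmDE, mulmnE, mnmE).
      by rewrite divnMDl ?pexp_gt0 // divn_small // addn0.
    apply/mnmP => i; rewrite !(mnmDE, mulmnE, mnmE) ffunE /=.
    exact: divn_eq.
  by case: eqP => _ /=; rewrite ?mcoeffX ?mcoeff0.
rewrite (bigD1 u0) //= big1 => [|u /negbTE u_u0]; last first.
  by rewrite partX u_u0 rmorph0 mulr0.
rewrite partX eqxx addr0 frobX_mnm -mpolyXD; congr 'X_[_]; apply/mnmP => i.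
by rewrite !(mnmDE, mulmnE, mnmE) ffunE /= addnC; apply: divn_eq.
Qed.

(* Linear systems with coefficients in the subfield of [q]-th powers which are
   solvable in [k] are solvable in the subfield; this is Gaussian elimination. *)
Lemma frob_descent (b : R -> Prop) (l : seq (k * R)) (F : R) : is_ideal b ->
  (forall y, y \in l -> b y.2) -> sig F = \sum_(y <- l) y.1 *: sig y.2 -> b F.
Proof.
move=> hb; have bZ c g : b g -> b (c *: g) by rewrite -mul_mpolyC; apply: idealMl.
have [j] := ubnP (size l); elim: j l F => // j IH [|[c G] l] F /=; rewrite ?ltnS => lj bl.
  rewrite big_nil => F0; suff -> : F = 0 by apply: ideal0.
  apply/mpolyP => w; have := congr1 (mcoeff w) F0.
  rewrite mcoeff_map_mpoly !mcoeff0 /= => /eqP; rewrite fmorph_eq0 => /eqP //.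
have bG : b G by apply: (bl (c, G)); apply: mem_head.
have {}bl y : y \in l -> b y.2 by move=> yl; apply: bl; rewrite in_cons yl orbT.
rewrite big_cons /= => FE.
have [G0|/mlead_supp] := eqVneq G 0.
  by apply: (IH l) => //; rewrite FE G0 rmorph0 scaler0 add0r.
rewrite mcoeff_msupp; move: (mlead G) => w Gw.
(* Elimination with pivot the coefficient of [G] at [w]; dividing before applying [sig] keeps the
   reduced elements in the ring. *)
pose red (H : R) := H - (H@_w / G@_w) *: G.
have redw H : (sig (red H))@_w = 0.
  by rewrite mcoeff_map_mpoly /= mcoeffB mcoeffZ divfK // subrr rmorph0.
have sigred H : sig (red H) = sig H - frobk hp (H@_w / G@_w) *: sig G.
  by rewrite rmorphB /= map_mpolyZ.
have [d dE] : exists d, sig (red F) = \sum_(y <- l) y.1 *: sig (red y.2) + d *: sig G.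
  exists (c + \sum_(y <- l) y.1 * frobk hp (y.2@_w / G@_w) - frobk hp (F@_w / G@_w)).
  rewrite sigred FE.
  under [in RHS]eq_bigr do rewrite sigred scalerBr scalerA.
  rewrite sumrB scalerBl scalerDl scaler_suml.
  rewrite [c *: _ + \sum_(y <- l) (y.1 * _) *: _]addrC [RHS]addrA addrA subrK.
  by rewrite [c *: _ + _]addrC.
(* Every reduced element has zero coefficient at [w], while that of [sig G] is nonzero. *)
have d0 : d = 0.
  move: (congr1 (mcoeff w) dE); rewrite redw mcoeffD mcoeffZ raddf_sum /= big1.
    rewrite add0r mcoeff_map_mpoly => /esym/eqP; rewrite mulf_eq0 fmorph_eq0.
    by rewrite (negbTE Gw) orbF => /eqP.
  by move=> y _; rewrite mcoeffZ redw mulr0.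
have : b (red F).
  apply: (IH [seq (y.1, red y.2) | y <- l]).
  - by rewrite size_map.
  - move=> _ /mapP[y yl ->] /=; apply: idealD => //; first exact: bl.
    by rewrite -scaleNr; apply: bZ.
  by rewrite big_map dE d0 scale0r addr0.
move=> bF; have -> : F = red F + (F@_w / G@_w) *: G by rewrite subrK.
by apply: idealD => //; apply: bZ.
Qed.

Lemma frob_pow_seq (b : R -> Prop) x : frob_pow b q x ->
  exists l : seq (R * R), (forall y, y \in l -> b y.2) /\ x = \sum_(y <- l) y.1 * y.2 ^+ q.
Proof.
move=> /(_ (fun x => exists l : seq (R * R),
  (forall y, y \in l -> b y.2) /\ x = \sum_(y <- l) y.1 * y.2 ^+ q)); apply.
  split; first by exists [::]; rewrite big_nil.
  split=> [y z [l [hl ->]] [l' [hl' ->]]|r y [l [hl ->]]].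
    exists (l ++ l'); rewrite big_cat; split=> // u.
    by rewrite mem_cat => /orP[/hl|/hl'].
  exists [seq (r * u.1, u.2) | u <- l]; split=> [u /mapP[v /hl h ->] //|].
  by rewrite big_map mulr_sumr; apply: eq_bigr => u _; rewrite mulrA.
move=> _ [y [by_ ->]]; exists [:: (1, y)]; rewrite big_seq1 mul1r; split=> // u.
by rewrite inE => /eqP ->.
Qed.

(** Taking the part at [u] of an expression of [g ^+ q * f] by [q]-th powers from [b] writes
    [sig (g * frob_part u f)] as a [k]-combination of elements [sig G] with [G] in [b];
    [frob_descent] removes [sig]. *)
Lemma frob_pow_part (b : R -> Prop) g f (u : 'X_{1..L}) : is_ideal b ->
  sig f = f -> (forall i, u i < q)%N ->
  frob_pow b q (g ^+ q * f) -> b (g * frob_part u f).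
Proof.
move=> hb sf uq /frob_pow_seq[l [bl fE]].
pose P (y : R * R) := frob_part u y.1.
apply: (@frob_descent b [seq ((P y)@_w, 'X_[w] * y.2) | y <- l, w <- msupp (P y)]) => //.
  move=> _ /allpairsPdep[y [w [yl _ ->]]] /=; apply: idealMl => //; exact: bl.
rewrite big_allpairs_dep /= rmorphM /= -frob_part_sig sf.
rewrite -(frob_partM _ _ uq) -frob_mpoly fE.
rewrite (big_morph _ (frob_partD u) (frob_part0 u)); apply: eq_bigr => y _.
rewrite frob_mpoly mulrC frob_partM // -/(P y) {1}[P y]mpolyE mulr_sumr.
apply: eq_bigr => w _.
by rewrite rmorphM /= map_mpolyX -scalerAr mulrC.
Qed.

(** The parts of [f] are also fixed by [sig], so [frobX] raises them to the power [q]. *)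
Lemma frob_pow_intro (b : R -> Prop) f : sig f = f ->
  (forall u : 'X_{1..L}, (forall i, u i < q)%N -> b (frob_part u f)) -> frob_pow b q f.
Proof.
move=> sf bf; rewrite (frob_part_expand f).
have hb := frob_pow_ideal b q.
apply: (ideal_sum hb) => u _ _; apply: (idealMl _ hb).
rewrite -[in frob_part _ _]sf frob_part_sig -frob_mpoly; apply: frob_powX.
by apply: bf => i; rewrite mnmE.
Qed.

End Frobenius.
(** * Test ideals *)

Section TestIdeals.
Variables (k : fieldType) (m n : nat) (hmn : (m.+1 <= n)%N).
Variables (p : nat) (hp : p \in [pchar k]).

Local Notation X := (generic_matrix k m.+1 n).
Local Notation I := (maximal_minors_ideal k m.+1 n).
Local Notation c := (corner k hmn).

(** With [m.+1] rows, the indices [m <= j] give the [h = n - m] minors of the overview. *)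
Definition corner_minor (j : 'I_n) :=
  minor X (fun l : 'I_m.+1 => if (l < m)%N then widen_ord hmn l else j).

Lemma corner_minor0 (j : 'I_n) : (j < m)%N -> corner_minor j = 0.
Proof.
move=> jm; apply: minor_ninj => inj.
have /(congr1 val) /= e : Ordinal (leqW jm) = ord_max :> 'I_m.+1.
  by apply: inj; rewrite /= jm ltnn; apply: val_inj.
by rewrite e ltnn in jm.
Qed.

(* Replacing the last row of [X] by a suitable combination of the rows multiplies
   the maximal minors by [c] and makes the last row equal to [corner_minor]. *)
Lemma corner_mul_minor a :
  exists D : 'I_m.+1 -> {mpoly k[m.+1 * n]},
    c * minor X a = \sum_i D i * corner_minor (a i).
Proof.
pose C l := cofactor (corner_mx k hmn) l ord_max.
have cE : c = C ord_max.
  rewrite /corner (expand_det_col _ ord_max) (bigD1 ord_max) //= mxE ltnn eqxx mul1r.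
  by rewrite big1 ?addr0 // => i /negbTE ni; rewrite mxE ltnn ni mul0r.
(* Cofactors along the last column ignore its entries, so those of [corner_mx] serve for every
   [j]. *)
have vE j : corner_minor j = \sum_l C l * X l j.
  rewrite /corner_minor /minor (expand_det_col _ ord_max); apply: eq_bigr => l _.
  set A := \matrix_(_, _) _.
  have -> : A l ord_max = X l j by rewrite [LHS]mxE ltnn.
  have -> : cofactor A l ord_max = C l.
    rewrite /C /cofactor; congr (_ * _).
    have -> : col' ord_max A = col' ord_max (corner_mx k hmn).
      by apply/matrixP => u v; rewrite [LHS]mxE [RHS]mxE [LHS]mxE [RHS]mxE lift_max ltn_ord.
    by [].
  exact: mulrC.
pose E : 'M[{mpoly k[m.+1 * n]}]_m.+1 :=
  \matrix_(i, j) if i == ord_max then C j else (i == j)%:R.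
have detE : \det E = c.
  rewrite det_trig.
    rewrite big_ord_recr /= mxE eqxx big1 ?mul1r // => i _; rewrite mxE eqxx.
    by rewrite ifN // -val_eqE /= ltn_eqF.
  apply/is_trig_mxP => i j ij; rewrite mxE ifN -?val_eqE /= ?(ltn_eqF ij) //.
  by rewrite ltn_eqF // (leq_trans ij) // -ltnS.
rewrite -detE -minor_mulmx /minor (expand_det_row _ ord_max).
exists (fun i => cofactor (\matrix_(i, j) (E *m X) i (a j)) ord_max i).
apply: eq_bigr => i _; rewrite mulrC; congr (_ * _); rewrite mxE mxE vE.
by apply: eq_bigr => l _; rewrite mxE eqxx.
Qed.

(** * Powers of [I] inside Frobenius powers *)

Section Upper.
Variable e : nat.
Local Notation q := (p ^ e)%N.
Let q0 : (0 < q)%N := pexp_gt0 hp e.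

(** Pigeonhole: write each multiplicity as [d j * q] plus a remainder. If the [d j] summed to less
    than [r], there would be at most [(r - 1) q + (n - m) (q - 1)] factors, which is less than
    [(r + n - m - 1) q]. *)
Lemma corner_minor_prod r (t : seq 'I_n) :
  all (fun j : 'I_n => m <= j)%N t -> size t = ((r + (n - m.+1)) * q)%N ->
  frob_pow (ideal_pow I r) q (\prod_(j <- t) corner_minor j).
Proof.
move=> tm st; pose d j := (count_mem j t %/ q)%N.
have hF := frob_pow_ideal (ideal_pow I r) q.
have -> : \prod_(j <- t) corner_minor j =
    \prod_(j < n) corner_minor j ^+ (count_mem j t %% q)%N *
    (\prod_(j < n) corner_minor j ^+ d j) ^+ q.
  rewrite -prodrXl -big_split /=.
  rewrite [RHS](eq_bigr (fun j => corner_minor j ^+ count_mem j t)) => [|j _]; last first.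
    by rewrite -exprM -exprD addnC -divn_eq.
  elim: t {tm st d} => [|j t IH]; first by rewrite big_nil big1 // => j _; rewrite expr0.
  rewrite big_cons IH (bigD1 j) //= [RHS](bigD1 j) //= eqxx exprS -mulrA.
  congr (_ * (_ * _)); apply: eq_bigr => l lj.
  by rewrite eq_sym (negbTE lj).
apply: (idealMl _ hF); apply: frob_powX.
have : ideal_pow I (\sum_(j < n) d j) (\prod_(j < n) corner_minor j ^+ d j).
  elim/big_ind2: _ => [|x1 x2 y1 y2 h1 h2|j _].
  - exact: ideal_pow0.
  - exact: ideal_powM.
  - by apply: ideal_pow_exp; apply: minor_maximal.
apply: ideal_pow_le; rewrite leqNgt; apply/negP => dr.
have : (size t <= \sum_(j < n | m <= j) (d j * q + q.-1))%N.
  have -> : size t = (\sum_(j < n | m <= j) count_mem j t)%N.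
    elim: t {st d dr} tm => [|j t IH /= /andP[mj /IH ->]]; first by rewrite big1.
    rewrite big_split /= -add1n; congr (_ + _)%N.
    rewrite (bigD1 j) //= eqxx big1 // => l /andP[_ lj].
    by rewrite eq_sym (negbTE lj).
  apply: leq_sum => j _; rewrite {1}(divn_eq (count_mem j t) q) leq_add2l.
  by rewrite -ltnS prednK // ltn_pmod.
rewrite big_split /= sum_nat_const -big_distrl /= st.
have -> : #|[pred j : 'I_n | m <= j]%N| = (n - m)%N.
  have hms : (m + (n - m) = n)%N by rewrite subnKC // ltnW.
  pose w (i : 'I_(n - m)) : 'I_n := cast_ord hms (rshift m i).
  have wi : injective w by move=> x y /(congr1 val) /= ?; apply: val_inj => /=; lia.
  rewrite -[RHS]card_ord -(card_imset predT wi); apply: eq_card => j.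
  rewrite !inE; apply/idP/imsetP => [mj|[i _ ->]]; last by rewrite /= leq_addr.
  have js' : (j - m < n - m)%N by have := ltn_ord j; lia.
  by exists (Ordinal js') => //; apply: val_inj => /=; lia.
have : (\sum_(j < n | m <= j) d j <= \sum_(j < n) d j)%N.
  by rewrite [A in (A <= _)%N]big_mkcond; apply: leq_sum => j _; case: ifP.
move: (\sum_(j < n | _) _)%N (\sum_(j < n) _)%N dr => x y yr xy; apply/negP.
rewrite -ltnNge.
have : ((x + (n - m)) * q <= (r + (n - m.+1)) * q)%N by rewrite leq_mul2r; lia.
apply: leq_trans; rewrite mulnDl -addnS leq_add2l.
by rewrite -(ltn_predK q0) /= mulnS -subn1; move: hmn; nia.
Qed.

(** Let [f] be a product of [M * q] minors. Multiplying each factor by [c] gives [(c ^+ M) ^+ q * f]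
    in [(I^r)^[q]]. Hence [c ^+ M] times each part of [f] lies in [I^r], where [c] cancels. Working
    with parts takes the place of flatness of Frobenius. *)
Lemma ideal_pow_sub_frob r :
  Defs.subset (ideal_pow I ((r + (n - m.+1)) * q)) (frob_pow (ideal_pow I r) q).
Proof.
set M := (r + _)%N.
have hF := frob_pow_ideal (ideal_pow I r) q.
apply: ideal_pow_gen => // s sM sS.
have cs : frob_pow (ideal_pow I r) q ((c ^+ M) ^+ q * \prod_(y <- s) y).
  pose S' y := exists2 j : 'I_n, (m <= j)%N & y = corner_minor j.
  have : ideal_pow (gen_ideal S') (M * q) (\prod_(y <- s) (c * y)).
    apply: ideal_pow_prod => // y /sS[a [_ ->]].
    have [D ->] := corner_mul_minor a; have hS := gen_ideal_ideal S'.
    apply: (ideal_sum hS) => i _ _; apply: (idealMl _ hS).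
    case: (ltnP (a i) m) => am; first by rewrite corner_minor0 //; apply: (ideal0 hS).
    by apply: gen_idealS; exists (a i).
  have -> : \prod_(y <- s) (c * y) = (c ^+ M) ^+ q * \prod_(y <- s) y.
    by rewrite big_split /= big_const_seq count_predT iter_mulr_1 -exprM sM.
  apply: ideal_pow_gen => // t tM tS.
  have [t' tt' tm] : exists2 t' : seq 'I_n, t = map corner_minor t' &
      all (fun j : 'I_n => m <= j)%N t'.
    elim: t tS {tM} => [|y t IH] tS; first by exists [::].
    have [|t' -> tm] := IH; first by move=> z zt; apply: tS; rewrite in_cons zt orbT.
    have [j mj ->] := tS y (mem_head _ _); exists (j :: t') => //=.
    by rewrite mj.
  rewrite tt' big_map; apply: corner_minor_prod => //.
  by rewrite -tM tt' size_map.
have sf : map_mpoly (frobk e hp) (\prod_(y <- s) y) = \prod_(y <- s) y.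
  rewrite rmorph_prod big_seq [RHS]big_seq; apply: eq_bigr => y /sS[a [_ ->]].
  rewrite /= -det_map_mx; congr (\det _); apply/matrixP => i j.
  by rewrite !mxE /= map_mpolyX.
apply: (frob_pow_intro sf) => u uq.
apply: (@corner_exp_nzd k m n hmn r M).
exact: (frob_pow_part (ideal_pow_ideal I r) sf uq cs).
Qed.

End Upper.

End TestIdeals.

(** * Lower bound from bands of consecutive columns *)

Section LowerBound.
Variables (k : fieldType) (m n : nat) (hmn : (m.+1 <= n)%N).

Local Notation X := (generic_matrix k m.+1 n).
Local Notation I := (maximal_minors_ideal k m.+1 n).

Lemma band_proof (j : 'I_(n - m)) (i : 'I_m.+1) : (i + j < n)%N.
Proof. by have := ltn_ord i; have := ltn_ord j; lia. Qed.

Definition band (j : 'I_(n - m)) (i : 'I_m.+1) : 'I_n := Ordinal (band_proof j i).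

Lemma increasing_band j : increasing (band j).
Proof. by apply/increasingP => i i' ii /=; rewrite ltn_add2r. Qed.

Variables (p : nat) (hp : p \in [pchar k]) (e : nat).
Local Notation q := (p ^ e)%N.
Let q0 : (0 < q)%N := pexp_gt0 hp e.

Definition band_prod := \prod_(j < n - m) minor X (band j) ^+ q.-1.

Definition band_mnm := (\sum_(j < n - m) diag_mnm (band j) *+ q.-1)%MM.

Lemma mlead_band_prod : mlead band_prod = band_mnm.
Proof.
rewrite /band_prod mlead_prod => [|j _ _]; last first.
  by rewrite expf_neq0 // minor_neq0 // increasing_band.
apply: eq_bigr => j _; rewrite mleadX ?minor_neq0 ?increasing_band //.
by rewrite mlead_minor // increasing_band.
Qed.

Lemma mcoeff_band_prod : band_prod@_band_mnm = 1.
Proof.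
have -> : band_mnm = (\sum_(j < n - m) mlead (minor X (band j) ^+ q.-1))%MM.
  apply: eq_bigr => j _; rewrite mleadX ?minor_neq0 ?increasing_band //.
  by rewrite mlead_minor // increasing_band.
rewrite mleadc_prod big1 // => j _.
rewrite mleadX ?minor_neq0 ?increasing_band // mleadcX.
by rewrite mlead_minor ?increasing_band // mcoeff_minor_diag ?increasing_band // expr1n.
Qed.

(** The entry [(i, l)] lies on the diagonal of at most one band, the one with [j = l - i], so its
    exponent is [0] or [q - 1]. *)
Lemma band_mnm_lt i : (band_mnm i < q)%N.
Proof.
case/mxvec_indexP: i => i l; rewrite mnm_sumE.
under eq_bigr do rewrite mulmnE diag_mnmE.
case: (pickP (fun j => band j i == l)) => [j /eqP jl|no]; last first.
  by rewrite big1 // => j _; rewrite no.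
rewrite (bigD1 j) //= big1 => [|j' jj'].
  by rewrite jl eqxx mul1n addn0 prednK.
case: eqP => // /(congr1 val) /=; rewrite -jl /= => /addnI e'.
by case/eqP: jj'; apply: val_inj.
Qed.

(** For [w != 0] the exponent [w q + band_mnm] has larger degree than the leading one, so its
    coefficient is zero. *)
Lemma frob_part_band : frob_part p e band_mnm band_prod = 1.
Proof.
apply/mpolyP => w; rewrite (mcoeff_frob_part hp) mcoeff1.
have [->|w0] := eqVneq w 0%MM.
  have -> : (0 *+ q + band_mnm)%MM = band_mnm :> 'X_{1..m.+1 * n}.
    by apply/mnmP => i; rewrite !(mnmDE, mulmnE, mnm0E) mul0n.
  exact: mcoeff_band_prod.
apply: mcoeff_gt_mlead; rewrite mlead_band_prod; apply: lt_mdeg_ltmc.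
rewrite mdegD mdegMn -[ltnLHS]add0n ltn_add2r muln_gt0 q0 andbT lt0n.
by rewrite mdeg_eq0.
Qed.

Lemma ideal_pow_sub_root r (b : {mpoly k[m.+1 * n]} -> Prop) : is_ideal b ->
  Defs.subset (ideal_pow I (r * q + (n - m) * q.-1)) (frob_pow b q) ->
  Defs.subset (ideal_pow I r) b.
Proof.
move=> hb Ib; apply: ideal_pow_gen => // s sr sS.
(* The factor [1] is written as a part of [band_prod], so that only the [q]-th power of the product
   times [band_prod] has to be placed in [b^[q]]. *)
have -> : \prod_(y <- s) y = \prod_(y <- s) y * frob_part p e band_mnm band_prod.
  by rewrite frob_part_band mulr1.
apply: (frob_pow_part (hp := hp)) => //.
- rewrite /band_prod rmorph_prod; apply: eq_bigr => j _.
  rewrite rmorphXn /= -det_map_mx; congr (\det _ ^+ _); apply/matrixP => i l.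
  by rewrite !mxE /= map_mpolyX.
- exact: band_mnm_lt.
apply: Ib; apply: ideal_powM.
  elim: s r sr sS => [|y s IH] r <- sS; first exact: ideal_pow0.
  rewrite big_cons exprMn /= [(_.+1 * q)%N]mulSn; apply: ideal_powM.
    apply: ideal_pow_exp; have [a [_ ->]] := sS y (mem_head _ _).
    exact: minor_maximal.
  by apply: IH => // z zs; apply: sS; rewrite in_cons zs orbT.
have -> : ((n - m) * q.-1 = \sum_(j < n - m) q.-1)%N by rewrite sum_nat_const card_ord.
rewrite /band_prod; elim/big_ind2: _ => [|x1 x2 y1 y2 h1 h2|j _].
- exact: ideal_pow0.
- exact: ideal_powM.
- by apply: ideal_pow_exp; apply: minor_maximal.
Qed.

(** Specialize [X] to [t] on the diagonal and [0] elsewhere. Every maximal minor becomes a multiple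
    of [t ^ (m + 1)] and the first one equals it, so its [r]-th power has too small an order in [t]
    to come from [I^(r+1)]. *)
Lemma ideal_pow_strict r : ~ Defs.subset (ideal_pow I r) (ideal_pow I r.+1).
Proof.
pose M : 'M[{mpoly k[1]}]_(m.+1, n) :=
  \matrix_(i, j) ('X_ord0 * (i == j :> nat)%:R).
have minorM a : exists y, minor M a = 'X_ord0 ^+ m.+1 * y.
  exists (\det (\matrix_(i, j) (i == a j :> nat)%:R)); rewrite -detZ.
  by congr (\det _); apply/matrixP => i j; rewrite !mxE.
pose J g := exists y, mxsubst M g = 'X_ord0 ^+ (m.+1 * r.+1) * y.
have hJ : is_ideal J.
  split; first by exists 0; rewrite rmorph0 mulr0.
  split=> [x y [x' xE] [y' yE]|x y [y' yE]].
    by exists (x' + y'); rewrite rmorphD /= xE yE mulrDr.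
  by exists (mxsubst M x * y'); rewrite rmorphM /= yE mulrCA.
have IJ : Defs.subset (ideal_pow I r.+1) J.
  apply: ideal_pow_gen => // s sr; rewrite /J -{}sr.
  elim: s => [|x s IH] sS; first by exists 1; rewrite big_nil muln0 expr0 rmorph1 mulr1.
  have [|y yE] := IH; first by move=> z zs; apply: sS; rewrite in_cons zs orbT.
  have [a [_ ->]] := sS x (mem_head _ _); have [z zE] := minorM a.
  exists (z * y); rewrite big_cons rmorphM /= yE mxsubst_minor zE.
  by rewrite mulnS exprD mulrACA.
pose a := widen_ord hmn.
have DI : ideal_pow I r (minor X a ^+ r) by apply: ideal_pow_exp; apply: minor_maximal.
move=> /(_ _ DI) /IJ[y].
rewrite rmorphXn /= mxsubst_minor.
have -> : minor M a = 'X_ord0 ^+ m.+1.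
  rewrite /minor (_ : \matrix_(_, _) _ = ('X_ord0)%:M) ?det_scalar //.
  by apply/matrixP => i j; rewrite !mxE /= mulr_natr.
rewrite -exprM mulnS addnC exprD -mulrA -[LHS]mulr1.
move=> /(mulfI _) e1; have : 'X_ord0 ^+ (m.+1 * r) != 0 :> {mpoly k[1]}.
  by rewrite expf_neq0 // -msupp_eq0 msuppX.
move=> /e1 /(congr1 (meval (fun=> 0))).
rewrite meval1 mevalM rmorphXn /= mevalXU exprS !mul0r => /eqP.
by rewrite oner_eq0.
Qed.

End LowerBound.

(** * Computation of the test ideals *)

Section TestIdealBounds.
Variables (k : fieldType) (p : nat) (hp : p \in [pchar k]).
Variables (m n : nat) (hmn : (m.+1 <= n)%N) (Rl : realType).

Local Notation I := (maximal_minors_ideal k m.+1 n).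

Lemma ideal_pow_sub_test_ideal (lam : Rl) r : lam < (r + (n - m))%:R ->
  Defs.subset (ideal_pow I r) (test_ideal p lam I).
Proof.
move=> lr x xr; rewrite /test_ideal; case: ifPn => //; rewrite -ltNge => l0.
set h := (n - m)%N in lr *.
have d0 : 0 < (r + h)%:R - lam by rewrite subr_gt0.
(* As [q >= e], this gives [h <= q (r + h - lam)], that is [lam q <= r q + h (q - 1)], which bounds
   the ceiling. *)
pose e := Num.bound ((h%:R + 1) / ((r + h)%:R - lam)).
exists e => b hb Ib; apply: (ideal_pow_sub_root hmn hp (e := e) hb) xr => y yI.
apply: Ib; apply: ideal_pow_le yI; rewrite -/h.
have q0 := pexp_gt0 hp e.
have eq : (e%:R <= (p ^ e)%:R :> Rl).
  by rewrite ler_nat ltnW // ltn_expl // prime_gt1 // (pcharf_prime hp).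
have be : (h%:R + 1) / ((r + h)%:R - lam) < e%:R.
  apply: archi_boundP; apply: divr_ge0; last exact: ltW.
  by rewrite addr_ge0 // ler0n.
rewrite ltr_pdivrMr // in be.
rewrite -lez_nat gez0_abs; last first.
  by rewrite ceil_ge0 (lt_le_trans (ltrN10 _)) // mulr_ge0 ?ler0n // ltW.
rewrite ceil_le_int -pmulrn natrD !natrM -subn1 natrB //.
move: be eq d0; rewrite natrD; move: (p ^ e)%:R e%:R h%:R r%:R => Q E H' r' be eq d0.
have : E * (r' + H' - lam) <= Q * (r' + H' - lam) by rewrite ler_wpM2r // ltW.
lra.
Qed.

Lemma test_ideal_sub_ideal_pow (lam : Rl) r : 0 < lam -> (r + (n - m.+1))%:R <= lam ->
  Defs.subset (test_ideal p lam I) (ideal_pow I r).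
Proof.
move=> l0 rl x; rewrite /test_ideal leNgt l0 /= => -[e]; apply.
  exact: ideal_pow_ideal.
move=> y yI; apply: (@ideal_pow_sub_frob k m n hmn p hp e r y).
apply: ideal_pow_le yI.
have q0 : 0 < (p ^ e)%:R :> Rl by rewrite ltr0n (pexp_gt0 hp).
rewrite -lez_nat gez0_abs; last first.
  by rewrite ceil_ge0 (lt_le_trans (ltrN10 _)) // mulr_ge0 // ltW.
rewrite -(ler_int Rl) -pmulrn natrM; apply: le_trans (ceil_ge _).
by rewrite ler_wpM2r // ltW.
Qed.

Lemma test_idealE (lam : Rl) r : (r + (n - m.+1))%:R <= lam < (r + (n - m))%:R ->
  set_eq (test_ideal p lam I) (ideal_pow I r).
Proof.
move=> /andP[rl lr] x; split; last exact: ideal_pow_sub_test_ideal.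
case: (ltP 0 lam) => [l0|]; first exact: test_ideal_sub_ideal_pow.
(* For [lam <= 0] the test ideal is the whole ring by definition, and the lower bound on [lam]
   forces [r = 0]. *)
move=> l0 _; have := le_trans rl l0; rewrite lern0 addn_eq0 => /andP[/eqP -> _].
exact: ideal_pow0.
Qed.

Lemma test_ideal_unit (lam : Rl) : lam < (n - m)%:R ->
  set_eq (test_ideal p lam I) unit_ideal.
Proof.
move=> l x; split=> // _; apply: (@ideal_pow_sub_test_ideal _ 0 l).
exact: ideal_pow0.
Qed.

End TestIdealBounds.

Theorem mainTheorem1 (k : fieldType) (p : nat) (hp : p \in [pchar k])
  (m n : nat) (hm : (1 <= m)%N) (hmn : (m <= n)%N) (Rl : realType) :
  let I := maximal_minors_ideal k m n in
  is_fpt p I ((n - m + 1)%N%:R : Rl) /\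
  (forall lambda : Rl,
     F_jumping p I lambda <->
     exists N : int, lambda = N%:~R /\ (N >= (n - m + 1)%N%:Z)%R) /\
  (forall lambda : Rl, ((n - m)%N%:R <= lambda) ->
     set_eq (test_ideal p lambda I)
            (ideal_pow I `|Num.floor lambda - (n - m)%N%:Z|%N)) /\
  (forall lambda : Rl, 0 <= lambda -> lambda < (n - m + 1)%N%:R ->
     set_eq (test_ideal p lambda I) unit_ideal).
Proof.
move=> I; rewrite {}/I; case: m hm hmn => // m _ hmn.
set I := maximal_minors_ideal k m.+1 n.
(* The number of rows is now [m.+1], so the threshold reads [n - m]. *)
have hE : (n - m.+1 + 1 = n - m)%N by lia.
have floorE (lam : Rl) : (n - m.+1)%:R <= lam ->
    set_eq (test_ideal p lam I) (ideal_pow I `|Num.floor lam - (n - m.+1)%N%:Z|%N).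
  move=> hl; apply: test_idealE => //.
  have fl : (n - m.+1)%N%:Z <= Num.floor lam by rewrite floor_ge_int -pmulrn.
  have aE : (`|Num.floor lam - (n - m.+1)%N%:Z|%N + (n - m.+1))%N%:Z = Num.floor lam.
    by rewrite PoszD gez0_abs ?subrK // subr_ge0.
  have /andP[fl1 fl2] := floor_itv lam.
  by rewrite -hE addnA addn1 -natr1 pmulrn aE fl1 /= intrD in fl2 *.
have strict r : ~ Defs.subset (ideal_pow I r) (ideal_pow I r.+1).
  exact: ideal_pow_strict.
rewrite hE; split; [|split; [|split]] => //.
- split; first by rewrite ltr0n subn_gt0.
  split.
    (* At the threshold the test ideal lies in [I]; were it the unit ideal, [I^0] would lie in
       [I^1]. *)
    move=> h; apply: (strict 0%N) => x _.
    have h0 : 0 < (n - m)%:R :> Rl by rewrite ltr0n subn_gt0.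
    have h1 : (1 + (n - m.+1))%:R <= (n - m)%:R :> Rl by rewrite ler_nat addnC hE.
    by apply: (test_ideal_sub_ideal_pow hp hmn h0 h1); apply/h.
  move=> lam _ h; rewrite leNgt; apply/negP => lt; apply: h.
  exact: test_ideal_unit.
- move=> lam; split.
    move=> [l0 h].
    case: (ltP lam (n - m)%:R) => hl.
      (* Below the threshold both test ideals are the unit ideal; halving keeps the exponent
         positive. *)
      case: (h (lam / 2)) => [|x]; first by lra.
      have hl2 : lam - lam / 2 < (n - m)%:R by lra.
      by have := test_ideal_unit hp hmn hl x; have := test_ideal_unit hp hmn hl2 x; tauto.
    exists (Num.floor lam); split; last by rewrite floor_ge_int -pmulrn.
    apply/eqP; rewrite eq_le floor_le andbT leNgt; apply/negP => fl.
    (* With this [delta] the comparison is with the floor of [lam], which yields the same power of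
       [I]. *)
    have d0 : 0 < lam - (Num.floor lam)%:~R by rewrite subr_gt0.
    have hl' : (n - m.+1)%:R <= lam by apply: le_trans hl; rewrite ler_nat; lia.
    case: (h _ d0) => x; rewrite subKr.
    have hf : (n - m.+1)%:R <= (Num.floor lam)%:~R :> Rl.
      by rewrite pmulrn ler_int floor_ge_int -pmulrn.
    have := floorE _ hf x; rewrite intrKfloor; have := floorE _ hl' x.
    by tauto.
  move=> [N [-> hN]].
  have [r NE] : exists r, N = (r.+1 + (n - m.+1))%N%:Z.
    case: N hN => // N; rewrite lez_nat => hN; exists (N - (n - m))%N.
    by congr Posz; lia.
  rewrite {}NE {hN N} -pmulrn; split; first by rewrite ltr0n.
  (* At the integer the test ideal lies in [I^(r+1)], while at any smaller exponent it contains
     [I^r]. *)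
  move=> d d0 h; apply: (strict r) => x xr.
  have h0 : 0 < (r.+1 + (n - m.+1))%:R :> Rl by rewrite ltr0n.
  apply: (test_ideal_sub_ideal_pow hp hmn h0 (lexx _)); apply/h.
  apply: (ideal_pow_sub_test_ideal hp hmn) xr.
  have -> : (r + (n - m) = r.+1 + (n - m.+1))%N by lia.
  by lra.
- by move=> lam _ hl; apply: test_ideal_unit.
Qed.
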